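(* Let $R$ be a Noetherian local ring with infinite residue field. Assume $I$ is an ideal of $R$ with $\ell(I)=\mu(I)-n=s-n$, where $s=\mu(I)$, and let $J$ be a minimal reduction of $I$. If $h_1,\ldots,h_s$ is a minimal generating set of $I$, then $J$ has a generating set of the form $$(h_1+a_{1,1}h_{t_1}+\cdots+a_{1,n}h_{t_n},\;\ldots,\;h_s+a_{s,1}h_{t_1}+\cdots+a_{s,n}h_{t_n})$$ for some $1\le t_1,\ldots,t_n\le s$, where $a_{i,j}\in R$ for all $i,j$ and $a_{t_i,j}=-\delta_{ij}$ for all $1\le i,j\le n$.
   Context: $\delta_{ij}$ is the Kronecker delta. $\mu(I)$ denotes the minimal number of generators of $I$. A reduction of $I$ is an ideal $J\subset I$ with $I^{r+1}=JI^r$ for some integer $r\ge 0$; a minimal reduction is a reduction that is minimal with respect to inclusion. The analytic spread is $\ell(I)=\dim \mathcal{F}(I)$, where $\mathcal{F}(I)=\bigoplus_{i\ge 0} I^i/\mathfrak{m}I^i$ is the special fiber ring and $\mathfrak{m}$ is the maximal ideal of $R$. *)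

(* Defs.v *)
From HB Require Import structures.
From mathcomp Require Import all_boot all_algebra.
From mathcomp Require Import boolp classical_sets cardinality.

Set Implicit Arguments.
Unset Strict Implicit.
Unset Printing Implicit Defensive.

Import GRing.Theory.
Local Open Scope ring_scope.
Local Open Scope classical_set_scope.

(* MathComp's [idealr R] and [prime_idealr R] are boolean predicates and are
   always proper.  In the presence of the classical axioms they are exactly the
   proper, resp. prime, ideals of R.  Ideals that may be the whole ring are
   represented as sets satisfying [is_ideal]. *)

Section Ideals.
Variable R : comNzRingType.
Implicit Types (S A B I J : set R).

Definition is_ideal I : Prop :=
  [/\ I 0, (forall x y, I x -> I y -> I (x + y))
    & (forall a x, I x -> I (a * x))].

Definition ideal_gen S : set R :=
  [set x | exists k (c g : 'I_k -> R),
     (forall i, S (g i)) /\ x = \sum_(i < k) c i * g i].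

Definition ideal_mul A B : set R :=
  ideal_gen [set x | exists a b, [/\ A a, B b & x = a * b]].

Fixpoint ideal_exp I (k : nat) : set R :=
  if k is k'.+1 then ideal_mul I (ideal_exp I k') else setT.

Definition generates k (g : 'I_k -> R) I : Prop := ideal_gen (range g) = I.

Definition noetherian : Prop :=
  forall I, is_ideal I -> exists k (g : 'I_k -> R), generates g I.

Definition is_mu I (s : nat) : Prop :=
  (exists g : 'I_s -> R, generates g I) /\
  (forall k (g : 'I_k -> R), generates g I -> (s <= k)%N).

Definition minimal_generating k (g : 'I_k -> R) I : Prop :=
  generates g I /\
  (forall D : set 'I_k, D <> setT -> ideal_gen (g @` D) <> I).

Definition reduction I J : Prop :=
  [/\ is_ideal J, J `<=` I
    & exists r, ideal_exp I r.+1 = ideal_mul J (ideal_exp I r)].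

Definition minimal_reduction I J : Prop :=
  reduction I J /\ (forall K, reduction I K -> K `<=` J -> K = J).

Definition maximal_ideal (m : idealr R) : Prop :=
  forall m' : idealr R, {subset m <= m'} -> m' =i m.

Definition local_ring (m : idealr R) : Prop :=
  maximal_ideal m /\ (forall m' : idealr R, maximal_ideal m' -> m' =i m).

End Ideals.

Definition prime_chain (A : comNzRingType) (d : nat)
    (P : 'I_d.+1 -> prime_idealr A) : Prop :=
  forall i j : 'I_d.+1, (i < j)%N ->
    {subset P i <= P j} /\ ~ {subset P j <= P i}.

Definition has_krull_dim (A : comNzRingType) (d : nat) : Prop :=
  (exists P : 'I_d.+1 -> prime_idealr A, prime_chain P) /\
  (forall e (P : 'I_e.+1 -> prime_idealr A), prime_chain P -> (e <= d)%N).

Section IdealFacts.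
Variable R : comNzRingType.
Implicit Types (S A B I J : set R).

Lemma ideal_gen_ideal S : is_ideal (ideal_gen S).
Proof.
split.
- by exists 0%N, (fun=> 0), (fun=> 0); split=> [[]//|]; rewrite big_ord0.
- move=> x y [k [c [g [Sg ->]]]] [k' [c' [g' [Sg' ->]]]].
  exists (k + k')%N.
  exists (fun i => match fintype.split i with inl i => c i | inr i => c' i end).
  exists (fun i => match fintype.split i with inl i => g i | inr i => g' i end).
  split=> [i|]; first by case: (fintype.split i).
  rewrite big_split_ord /=; congr (_ + _); apply: eq_bigr => i _.
    by rewrite (unsplitK (inl i)).
  by rewrite (unsplitK (inr i)).
- move=> a x [k [c [g [Sg ->]]]]; exists k, (fun i => a * c i), g.
  by split=> //; rewrite mulr_sumr; apply: eq_bigr => i _; rewrite mulrA.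
Qed.

Lemma ideal_gen_sub S I : is_ideal I -> S `<=` I -> ideal_gen S `<=` I.
Proof.
move=> [I0 ID IM] SI x [k [c [g [Sg ->]]]].
by elim/big_rec: _ => // i y _ Iy; apply: ID => //; apply/IM/SI.
Qed.

Lemma sub_ideal_gen S : S `<=` ideal_gen S.
Proof.
move=> x Sx; exists 1%N, (fun=> 1), (fun=> x).
by split=> //; rewrite big_ord1 mul1r.
Qed.

Lemma ideal_sum I (T : Type) (r : seq T) (P : pred T) (F : T -> R) :
  is_ideal I -> (forall i, P i -> I (F i)) -> I (\sum_(i <- r | P i) F i).
Proof. by case=> I0 ID _ IF; elim/big_ind: _. Qed.

Lemma ideal_opp I x : is_ideal I -> I x -> I (- x).
Proof. by case=> _ _ IM Ix; rewrite -mulN1r; apply: IM. Qed.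

Lemma ideal_mul_ideal A B : is_ideal (ideal_mul A B).
Proof. exact: ideal_gen_ideal. Qed.

Lemma ideal_mulP A B a b : A a -> B b -> ideal_mul A B (a * b).
Proof. by move=> Aa Bb; apply: sub_ideal_gen; exists a, b. Qed.

Lemma ideal_mul_subr A B : is_ideal B -> ideal_mul A B `<=` B.
Proof.
by move=> iB; apply: ideal_gen_sub => // _ [a [b [_ Bb ->]]]; case: iB => _ _; apply.
Qed.

Lemma ideal_mul_subl A B : is_ideal A -> ideal_mul A B `<=` A.
Proof.
move=> iA; apply: ideal_gen_sub => // _ [a [b [Aa _ ->]]].
by rewrite mulrC; case: iA => _ _; apply.
Qed.

Lemma ideal_exp_ideal I k : is_ideal (ideal_exp I k).
Proof. by case: k => [|k] //=; apply: ideal_mul_ideal. Qed.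

Lemma ideal_expM I k l x y :
  ideal_exp I k x -> ideal_exp I l y -> ideal_exp I (k + l) (x * y).
Proof.
elim: k x => [|k IH] x /=.
  by move=> _ Iy; case: (ideal_exp_ideal I l) => _ _; apply.
move=> [p [c [g [Sg ->]]]] Iy; rewrite mulr_suml.
apply: ideal_sum => [|i _]; first exact: ideal_mul_ideal.
case: (Sg i) => [a [b [Ia Ib ->]]].
have -> : c i * (a * b) * y = c i * (a * (b * y)) by rewrite !mulrA.
case: (ideal_mul_ideal I (ideal_exp I (k + l))) => _ _; apply.
by apply: ideal_mulP => //; apply: IH.
Qed.

Lemma idealr_is_ideal (m : idealr R) : is_ideal [set` m].
Proof.
split=> /=; first exact: idealr0.
  by move=> x y; apply: rpredD.
by move=> a x; apply: idealMr.
Qed.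

End IdealFacts.

(* The Rees algebra R[It] = \bigoplus_i I^i t^i, as a subring of R[t]. *)
Section Rees.
Variables (R : comNzRingType) (I : set R).

Definition rees_pred : {pred {poly R}} :=
  fun p => `[< forall i, ideal_exp I i p`_i >].

Lemma rees_predP (p : {poly R}) :
  reflect (forall i, ideal_exp I i p`_i) (p \in rees_pred).
Proof. exact: asboolP. Qed.

Lemma rees_subring_closed : subring_closed rees_pred.
Proof.
split=> [|p q /rees_predP Ip /rees_predP Iq|p q /rees_predP Ip /rees_predP Iq];
  apply/rees_predP => i.
- by case: i => // i; rewrite coef1 /=; case: (ideal_exp_ideal I i.+1).
- have iI := ideal_exp_ideal I i; rewrite coefB.
  by case: (iI) => _ ID _; apply: ID => //; apply: ideal_opp.
- rewrite coefM; apply: ideal_sum => [|j _]; first exact: ideal_exp_ideal.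
  by have := ideal_expM (Ip j) (Iq (i - j)%N); rewrite subnKC // -ltnS.
Qed.

HB.instance Definition _ :=
  GRing.isSubringClosed.Build {poly R} rees_pred rees_subring_closed.

Record rees := Rees { rees_val : {poly R}; _ : rees_val \in rees_pred }.

HB.instance Definition _ := [isSub for rees_val].
HB.instance Definition _ := [Choice of rees by <:].
HB.instance Definition _ := [SubChoice_isSubComNzRing of rees by <:].

End Rees.

(* The quotient of \bigoplus_i I^i t^i by its homogeneous ideal
   \bigoplus_i m I^i t^i, i.e. \bigoplus_i I^i / m I^i with the product induced
   by I^i x I^j -> I^(i+j); see [special_fiber_eqP]. *)
Section SpecialFiber.
Variables (R : comNzRingType) (m : idealr R) (I : set R).

Definition fiber_ideal : {pred rees I} :=
  fun p => `[< forall i, ideal_mul [set` m] (ideal_exp I i) (rees_val p)`_i >].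

Lemma fiber_idealP (p : rees I) :
  reflect (forall i, ideal_mul [set` m] (ideal_exp I i) (rees_val p)`_i)
          (p \in fiber_ideal).
Proof. exact: asboolP. Qed.

Lemma fiber_ideal_closed : idealr_closed fiber_ideal.
Proof.
split.
- apply/fiber_idealP => i; rewrite coef0.
  by case: (ideal_mul_ideal [set` m] (ideal_exp I i)).
- apply/negP => /fiber_idealP/(_ 0%N); rewrite coef1 /=.
  by move/(ideal_mul_subl (idealr_is_ideal m)); rewrite /= idealr1.
- move=> a u v /fiber_idealP mu /fiber_idealP mv; apply/fiber_idealP => i.
  have iM := ideal_mul_ideal [set` m] (ideal_exp I i).
  rewrite coefD; case: (iM) => _ ID _; apply: ID => //.
  rewrite coefM; apply: ideal_sum => // j _.
  have /rees_predP/(_ j) Ia := valP a.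
  have [k [c [g [Sg ->]]]] := mu (i - j)%N.
  rewrite mulr_sumr; apply: ideal_sum => // l _.
  case: (Sg l) => [x [y [mx Iy ->]]].
  rewrite !mulrA (mulrC _ (c l)) -!mulrA; case: (iM) => _ _; apply.
  rewrite mulrCA; apply: ideal_mulP => //.
  by have := ideal_expM Ia Iy; rewrite subnKC // -ltnS.
Qed.

HB.instance Definition _ :=
  isIdealr.Build (rees I) fiber_ideal fiber_ideal_closed.

Definition special_fiber : comNzRingType := {ideal_quot fiber_ideal}.

Lemma special_fiber_eqP (p q : rees I) :
  reflect
    (forall i, ideal_mul [set` m] (ideal_exp I i)
                 ((rees_val p)`_i - (rees_val q)`_i))
    (\pi_({ideal_quot fiber_ideal})%qT p == \pi_({ideal_quot fiber_ideal})%qT q).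
Proof.
rewrite -Quotient.idealrBE; apply: (iffP (fiber_idealP _)) => H i;
  by have := H i; rewrite coefB.
Qed.

Definition has_analytic_spread (l : nat) : Prop := has_krull_dim special_fiber l.

End SpecialFiber.

(* Main.v *)
(** Let T be a set of indices of minimal cardinality with I = J + (h_j : j in T).
    Each h_i is then congruent modulo J to a combination of the h_j, j in T, and
    the corresponding elements v_i of J, for i not in T, span J modulo m I; hence
    they generate a reduction of I, which is J by minimality.  It remains to see
    that the number d of these generators is the Krull dimension l of the fiber
    ring F, and both inequalities follow by counting monomials.

    - l <= d: F is a finite module over the subalgebra generated by d elements,
      so any d + 1 elements of F are algebraically dependent over the residue
      field; a relation between elements y_i in P_(i+1) \ P_i contradicts the
      existence of a chain of d + 2 primes P_i.

    - d <= l: if F has no chain of d + 1 primes, then Zorn's lemma provides a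
      relation x_0^n_0 (x_1^n_1 (... (x_(d-1)^n_(d-1) (1 + a_(d-1) x_(d-1)) ...)
      + a_0 x_0) = 0 in F (Coquand and Lombardi).  Its homogeneous part rewrites
      multiples of x^n into lexicographically larger monomials, so F grows too
      slowly for the generators of J to be algebraically independent.  Since the
      residue field is infinite, a linear change of variables makes a form
      vanishing on the generators monic, so that d - 1 elements of J generate a
      reduction of I; it is J by minimality, and I has s - 1 generators. *)

Require Import Defs.
From HB Require Import structures.
From mathcomp Require Import all_boot all_algebra.
From mathcomp Require Import boolp classical_sets cardinality.
From mathcomp Require Import zify ring.

Set Implicit Arguments.
Unset Strict Implicit.
Unset Printing Implicit Defensive.

Import GRing.Theory.
Local Open Scope ring_scope.
Local Open Scope classical_set_scope.

(** * Ideals as sets: sums, products, powers, and primes avoiding a monoid *)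

Section IdealCalculus.
Variable R : comNzRingType.
Implicit Types (A B C I J L M : set R).

Definition ideal_add A B : set R :=
  [set z | exists a b, [/\ A a, B b & z = a + b]].

Lemma ideal_zero I : is_ideal I -> I 0.
Proof. by case. Qed.

Lemma ideal_addr I x y : is_ideal I -> I x -> I y -> I (x + y).
Proof. by case=> _ + _; apply. Qed.

Lemma ideal_mulr I a x : is_ideal I -> I x -> I (a * x).
Proof. by case=> _ _; apply. Qed.

Lemma ideal_subr I x y : is_ideal I -> I x -> I y -> I (x - y).
Proof. by move=> iI Ix Iy; apply: ideal_addr => //; apply: ideal_opp. Qed.

Lemma ideal_add_ideal A B : is_ideal A -> is_ideal B -> is_ideal (ideal_add A B).
Proof.
move=> iA iB; split.
- by exists 0, 0; rewrite addr0; split=> //; apply: ideal_zero.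
- move=> _ _ [a [b [Aa Bb ->]]] [a' [b' [Aa' Bb' ->]]].
  by exists (a + a'), (b + b'); rewrite addrACA; split=> //; apply: ideal_addr.
- move=> c _ [a [b [Aa Bb ->]]]; exists (c * a), (c * b).
  by rewrite mulrDr; split=> //; apply: ideal_mulr.
Qed.

Lemma ideal_addl A B : is_ideal B -> A `<=` ideal_add A B.
Proof.
by move=> iB a Aa; exists a, 0; rewrite addr0; split=> //; apply: ideal_zero.
Qed.

Lemma ideal_add_inr A B : is_ideal A -> B `<=` ideal_add A B.
Proof.
by move=> iA b Bb; exists 0, b; rewrite add0r; split=> //; apply: ideal_zero.
Qed.

Lemma ideal_add_sub A B C : is_ideal C -> A `<=` C -> B `<=` C ->
  ideal_add A B `<=` C.
Proof.
by move=> iC sAC sBC _ [a [b [Aa Bb ->]]]; apply: ideal_addr; [|apply: sAC|apply: sBC].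
Qed.

Lemma ideal_mul_sub A B C : is_ideal C ->
  (forall a b, A a -> B b -> C (a * b)) -> ideal_mul A B `<=` C.
Proof.
by move=> iC H; apply: ideal_gen_sub => // _ [a [b [Aa Bb ->]]]; apply: H.
Qed.

Lemma ideal_mulS A A' B B' : A `<=` A' -> B `<=` B' ->
  ideal_mul A B `<=` ideal_mul A' B'.
Proof.
move=> AA' BB'; apply: ideal_mul_sub => [|a b Aa Bb].
  exact: ideal_mul_ideal.
by apply: ideal_mulP; [apply: AA'|apply: BB'].
Qed.

(** This is the colon ideal (C : y). It allows a claim about products to be checked on generators of
    one factor. *)
Lemma ideal_colon C y : is_ideal C -> is_ideal [set z | C (z * y)].
Proof.
move=> iC; split=> /= [|x z Cx Cz|a x Cx].
- by rewrite mul0r; apply: ideal_zero.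
- by rewrite mulrDl; apply: ideal_addr.
- by rewrite -mulrA; apply: ideal_mulr.
Qed.

Lemma ideal_gen_mulr S C y : is_ideal C -> (forall x, S x -> C (x * y)) ->
  forall x, ideal_gen S x -> C (x * y).
Proof. by move=> iC SC x; apply: (ideal_gen_sub (ideal_colon y iC)). Qed.

Lemma ideal_mul_gen_mulr A B C y : is_ideal C ->
  (forall a b, A a -> B b -> C (a * b * y)) ->
  forall x, ideal_mul A B x -> C (x * y).
Proof.
by move=> iC H; apply: ideal_gen_mulr => // _ [a [b [Aa Bb ->]]]; apply: H.
Qed.

Lemma ideal_exp_decr I k : ideal_exp I k.+1 `<=` ideal_exp I k.
Proof. by apply: ideal_mul_subr; apply: ideal_exp_ideal. Qed.

Lemma ideal_exp_le I k l :
  (k <= l)%N -> ideal_exp I l `<=` ideal_exp I k.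
Proof.
move=> /subnKC <-; elim: (l - k)%N => [|j IH]; first by rewrite addn0.
by rewrite addnS; apply: subset_trans IH; apply: ideal_exp_decr.
Qed.

Lemma ideal_mul_expr A I k l y z :
  ideal_mul A (ideal_exp I k) z -> ideal_exp I l y ->
  ideal_mul A (ideal_exp I (k + l)) (z * y).
Proof.
move=> mz Iy; apply: ideal_mul_gen_mulr mz => [|a b ma Ib].
  exact: ideal_mul_ideal.
by rewrite -mulrA; apply: ideal_mulP => //; apply: ideal_expM.
Qed.

Lemma ideal_exp1 I x : I x -> ideal_exp I 1 x.
Proof. by move=> Ix; rewrite -[x]mulr1; apply: ideal_mulP. Qed.

(** The combinations with a single coefficient per index already form an ideal containing every
    generator. *)
Lemma ideal_gen_finPT (T : finType) (P : pred T) (g : T -> R) x :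
  ideal_gen [set g t | t in [set t | P t]] x ->
  exists c : T -> R, x = \sum_(t | P t) c t * g t.
Proof.
move=> gx; pose C := [set x | exists c : T -> R, x = \sum_(t | P t) c t * g t].
suff: C x by [].
move: x gx; apply: ideal_gen_sub => [|_ [i /= Pi <-]].
  split.
  - by exists (fun=> 0); rewrite big1 // => i _; rewrite mul0r.
  - move=> _ _ [c ->] [c' ->]; exists (fun i => c i + c' i).
    by rewrite -big_split; apply: eq_bigr => i _; rewrite mulrDl.
  - move=> a _ [c ->]; exists (fun i => a * c i).
    by rewrite mulr_sumr; apply: eq_bigr => i _; rewrite mulrA.
exists (fun j => (j == i)%:R); rewrite (bigD1 i) //= eqxx mul1r big1 ?addr0 //.
by move=> j /andP[_ /negPf ->]; rewrite mul0r.
Qed.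

Lemma ideal_gen_finP (T : finType) (g : T -> R) x :
  ideal_gen (range g) x -> exists c : T -> R, x = \sum_t c t * g t.
Proof.
move=> gx; apply: (ideal_gen_finPT (P := predT)).
suff -> : [set g t | t in [set t | predT t]] = range g by [].
by congr (_ @` _); rewrite predeqE.
Qed.

(** Zorn's lemma in a form that serves twice: S = {1} gives maximal ideals, and a multiplicative set
    S gives primes. *)
Lemma ideal_maximal_disjoint (S Q : set R) : is_ideal Q ->
  (forall x, Q x -> ~ S x) ->
  exists P : set R, [/\ is_ideal P, Q `<=` P, (forall x, P x -> ~ S x) &
    forall P', is_ideal P' -> P `<=` P' -> (forall x, P' x -> ~ S x) -> P' `<=` P].
Proof.
move=> iQ QS.
(* The empty set is added so that the union of the empty chain qualifies. *)
pose good (P : set R) := [/\ is_ideal P, Q `<=` P & forall x, P x -> ~ S x].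
have [|P [gP maxP]] := @Zorn_bigcup R [set P | P = set0 \/ good P].
  move=> F FP Ftot /=.
  have [[X FX gX]|nF] := pselect (exists2 X, F X & good X); last first.
    left; rewrite predeqE => z; split=> // -[Y FY Yz].
    by case: (FP _ FY) => [E|gY]; [rewrite E in Yz|case: nF; exists Y].
  have gF Y y : F Y -> Y y -> good Y.
    by move=> /FP[-> //|].
  right; split.
  - split.
    + by exists X => //; case: gX => /ideal_zero.
    + move=> x y [Y FY Yx] [Z FZ Zy].
      have [iY _ _] := gF _ _ FY Yx; have [iZ _ _] := gF _ _ FZ Zy.
      case: (Ftot _ _ FY FZ) => YZ.
        by exists Z => //; apply: ideal_addr => //; apply: YZ.
      by exists Y => //; apply: ideal_addr => //; apply: YZ.
    + move=> a x [Y FY Yx]; exists Y => //.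
      by have [iY _ _] := gF _ _ FY Yx; apply: ideal_mulr.
  - by move=> q Qq; exists X => //; case: gX => _ + _; apply.
  - by move=> x [Y FY Yx]; case: (gF _ _ FY Yx) => _ _; apply.
have gQ : good Q by split.
have {}gP : good P.
  case: gP => // P0; case: (maxP Q); last by right.
  rewrite P0; split=> // Q0.
  by case: (Q0 0 (ideal_zero iQ)).
exists P; case: (gP) => iP QP PS; split=> // P' iP' PP' P'S; apply: contrapT => nP.
apply: (maxP P'); first by split.
by right; split=> //; apply: subset_trans PP'.
Qed.

Lemma asbool_idealr_closed (P : set R) : is_ideal P -> ~ P 1 ->
  idealr_closed (fun x => `[< P x >]).
Proof.
move=> iP P1; split.
- by apply/asboolP; apply: ideal_zero.
- by apply/negP => /asboolP.
- move=> a x y /asboolP Px /asboolP Py.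
  by apply/asboolP; apply: ideal_addr => //; apply: ideal_mulr.
Qed.

Lemma idealr_of_set (P : set R) : is_ideal P -> ~ P 1 ->
  exists p : idealr R, forall x, x \in p <-> P x.
Proof.
move=> iP P1; pose p : R -> bool := fun x => `[< P x >].
have pc : idealr_closed p := asbool_idealr_closed iP P1.
pose pI := HB.pack_for (idealr R) p (isIdealr.Build R p pc).
exists pI => x; split; first by move/asboolP.
by move=> Px; apply/asboolP.
Qed.

Lemma prime_idealr_of_set (P : set R) : is_ideal P -> ~ P 1 ->
  (forall x y, P (x * y) -> P x \/ P y) ->
  exists p : prime_idealr R, forall x, x \in p <-> P x.
Proof.
move=> iP P1 PM; pose p : R -> bool := fun x => `[< P x >].
have pc : idealr_closed p := asbool_idealr_closed iP P1.
have pp : prime_idealr_closed p.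
  by move=> x y /asboolP/PM[] Pz; apply/orP; [left|right]; apply/asboolP.
pose pI := HB.pack_for (prime_idealr R) p (isIdealr.Build R p pc)
  (isPrimeIdealrClosed.Build R p pp).
exists pI => x; split; first by move/asboolP.
by move=> Px; apply/asboolP.
Qed.

Lemma ideal_principal (x : R) : is_ideal (range (fun a => a * x)).
Proof.
split=> [|_ _ [a _ <-] [b _ <-]|c _ [a _ <-]].
- by exists 0; rewrite ?mul0r.
- by exists (a + b); rewrite ?mulrDl.
- by exists (c * a); rewrite ?mulrA.
Qed.

(** An ideal P maximal among those avoiding S is prime: if x and y are outside P, then S meets P +
    (x) and P + (y), and if xy were in P, the product of the two elements found would lie in both S
    and P. *)
Lemma prime_avoiding_monoid (S Q : set R) : is_ideal Q -> S 1 ->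
  (forall x y, S x -> S y -> S (x * y)) -> (forall x, Q x -> ~ S x) ->
  exists p : prime_idealr R,
    (forall x, Q x -> x \in p) /\ (forall x, x \in p -> ~ S x).
Proof.
move=> iQ S1 SM QS.
have [P [iP QP PS maxP]] := ideal_maximal_disjoint iQ QS.
have outP x : ~ P x -> exists a b, [/\ P a & S (a + b * x)].
  move=> nPx; apply: contrapT => nab; apply: nPx.
  have iPx := ideal_add_ideal iP (ideal_principal x).
  apply: (maxP _ iPx).
  - by apply: ideal_addl; apply: ideal_principal.
  - by move=> _ [a [_ [Pa [b _ <-] ->]]] Sab; apply: nab; exists a, b.
  - by apply: ideal_add_inr => //; exists 1; rewrite ?mul1r.
have [||p pP] := prime_idealr_of_set iP.
- by move=> /PS; apply.
- move=> x y Pxy; apply: contrapT => /not_orP[/outP[a [b [Pa Sa]]] /outP[c [e [Pc Sc]]]].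
  apply: (PS _ _ (SM _ _ Sa Sc)).
  have -> : (a + b * x) * (c + e * y) = (c + e * y) * a + (b * x * c + b * e * (x * y)).
    by ring.
  by do ![apply: ideal_addr => //|apply: ideal_mulr => //].
by exists p; split=> x; [move/QP/pP|move/pP/PS].
Qed.

End IdealCalculus.

(** * Local rings: units, Nakayama's lemma, linear algebra over the residue field *)

Section LocalRing.
Variables (R : comNzRingType) (m : idealr R).
Hypothesis Rlocal : local_ring m.
Implicit Types (I J L M : set R).

Lemma idealr_in_maximal (Q : set R) : is_ideal Q -> ~ Q 1 ->
  exists2 p : idealr R, maximal_ideal p & forall x, Q x -> x \in p.
Proof.
move=> iQ Q1; have [|P [iP QP P1 maxP]] := @ideal_maximal_disjoint R [set 1] Q iQ.
  by move=> x Qx x1; apply: Q1; rewrite -x1.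
have [|p pP] := idealr_of_set iP; first by move/P1; apply.
exists p => [p' pp' x|x /QP /pP //].
apply/idP/idP => [p'x|]; last exact: pp'.
apply/pP/(maxP [set` p']) => //; first exact: idealr_is_ideal.
  by move=> y /pP/pp'.
by move=> y /= p'y y1; move: p'y; rewrite y1 idealr1.
Qed.

(** For a in m, the element 1 - a is a unit, as otherwise it would lie in a maximal ideal, that is,
    in m. For x outside m, maximality of m gives 1 = a + b x with a in m. *)
Lemma local_unit x : x \notin m -> exists y, y * x = 1.
Proof.
case: Rlocal => maxm uniqm xm.
have unit1B a : a \in m -> exists y, y * (1 - a) = 1.
  move=> am; apply: contrapT => nu.
  have [|p maxp pa] := idealr_in_maximal (ideal_principal (1 - a)).
    by case=> y _ E; apply: nu; exists y.
  have : 1 - a \in m.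
    by rewrite -(uniqm _ maxp); apply: pa; exists 1; rewrite ?mul1r.
  by move=> /rpredD/(_ am); rewrite subrK idealr1.
have imx := ideal_add_ideal (idealr_is_ideal m) (ideal_principal x).
have [[a [_ [/= am [b _ <-] E]]]|n1] := pselect (ideal_add [set` m] (range (fun a => a * x)) 1).
  have [y Ey] := unit1B a am; exists (y * b).
  by rewrite -mulrA -Ey E addrC addKr.
have [p pP] := idealr_of_set imx n1.
have mp : {subset m <= p}.
  by move=> y my; apply/pP/ideal_addl => //; apply: ideal_principal.
have : x \in p.
  apply/pP/ideal_add_inr; first exact: idealr_is_ideal.
  by exists 1; rewrite ?mul1r.
by rewrite (maxm _ mp) (negPf xm).
Qed.

Lemma local_mulN x y : x \notin m -> y \notin m -> x * y \notin m.
Proof.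
move=> /local_unit[x' Ex] /negP ym; apply/negP => xym; apply: ym.
by have := idealMr x' xym; rewrite mulrA Ex mul1r.
Qed.

Lemma local_expN x n : x \notin m -> x ^+ n \notin m.
Proof.
move=> xm; elim: n => [|n IH]; first by rewrite expr0 idealr1.
by rewrite exprS local_mulN.
Qed.

Lemma local_prodN (T : finType) (P : pred T) (F : T -> R) :
  (forall t, P t -> F t \notin m) -> \prod_(t | P t) F t \notin m.
Proof.
move=> H; elim/big_ind: _ => //; first by rewrite idealr1.
exact: local_mulN.
Qed.

Lemma ideal_unitK L x y : is_ideal L -> x \notin m -> L (x * y) -> L y.
Proof.
move=> iL /local_unit[z zx] Lxy.
by rewrite -[y]mul1r -zx -mulrA; apply: ideal_mulr.
Qed.

(** One generator is eliminated: m M lies in L + m a, so (1 - c) a is in L for some c in m, and 1 -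
    c is a unit. *)
Lemma nakayama_step (M L : set R) (a : R) : is_ideal M -> is_ideal L ->
  M `<=` ideal_add L (ideal_mul [set` m] M) -> M a ->
  M `<=` ideal_add L (range (fun b => b * a)) -> M `<=` L.
Proof.
move=> iM iL ML Ma MLa.
have mM z : ideal_mul [set` m] M z -> exists l c, [/\ L l, c \in m & z = l + c * a].
  apply: (@ideal_mul_sub _ _ _ [set z | exists l c, [/\ L l, c \in m & z = l + c * a]]).
    split.
    - by exists 0, 0; rewrite mul0r addr0 idealr0; split=> //; apply: ideal_zero.
    - move=> _ _ [l [c [Ll mc ->]]] [l' [c' [Ll' mc' ->]]].
      exists (l + l'), (c + c'); rewrite mulrDl addrACA rpredD //.
      by split=> //; apply: ideal_addr.
    - move=> b _ [l [c [Ll mc ->]]]; exists (b * l), (b * c).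
      by rewrite mulrDr mulrA idealMr //; split=> //; apply: ideal_mulr.
  move=> c y /= mc /MLa[l [_ [Ll [b _ <-] ->]]]; exists (c * l), (b * c).
  by rewrite idealMr // mulrDr mulrA (mulrC c b); split=> //; apply: ideal_mulr.
have La : L a.
  have [l [z [Ll /mM[l' [c [Ll' mc ->]]] E]]] := ML _ Ma.
  have u : 1 - c \notin m.
    by apply/negP => /rpredD/(_ mc); rewrite subrK idealr1.
  apply: (ideal_unitK iL u).
  have -> : (1 - c) * a = l + l' by rewrite mulrBl mul1r {1}E; ring.
  exact: ideal_addr.
apply: (subset_trans MLa); apply: ideal_add_sub => // _ [b _ <-].
exact: ideal_mulr.
Qed.

(** The k generators of M are removed one at a time, starting from the last: by induction on j, M
    lies in L plus the ideal of its first k - j generators. *)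
Lemma nakayama (M L : set R) : noetherian R -> is_ideal M -> is_ideal L ->
  M `<=` ideal_add L (ideal_mul [set` m] M) -> M `<=` L.
Proof.
move=> Rnoeth iM iL ML; have [k [g gM]] := Rnoeth _ iM.
have gE i : M (g i) by rewrite -gM; apply: sub_ideal_gen; exists i.
pose Lj j := ideal_add L (ideal_gen [set g i | i in [set i : 'I_k | (i < j)%N]]).
suff H j : (j <= k)%N -> M `<=` Lj (k - j)%N.
  have := H k (leqnn _); rewrite subnn; move/subset_trans; apply.
  apply: ideal_add_sub => //; apply: ideal_gen_sub => // _ [i /= + <-].
  by rewrite ltn0.
elim: j => [|j IH] jk.
  rewrite subn0 -{1}gM; apply: ideal_gen_sub.
    by apply: ideal_add_ideal => //; apply: ideal_gen_ideal.
  move=> _ [i _ <-]; apply: ideal_add_inr => //; apply: sub_ideal_gen.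
  by exists i => //=.
have kj : (k - j.+1 < k)%N by lia.
have iLj : is_ideal (Lj (k - j.+1)%N).
  by apply: ideal_add_ideal => //; apply: ideal_gen_ideal.
apply: (@nakayama_step _ _ (g (Ordinal kj))) => //.
  apply: (subset_trans ML); apply: ideal_add_sub.
  - by apply: ideal_add_ideal => //; apply: ideal_mul_ideal.
  - move=> x Lx; apply: ideal_addl; first exact: ideal_mul_ideal.
    by apply: ideal_addl => //; apply: ideal_gen_ideal.
  - exact: ideal_add_inr.
apply: (subset_trans (IH (ltnW jk))).
have iT := ideal_add_ideal iLj (ideal_principal (g (Ordinal kj))).
apply: ideal_add_sub => //.
  move=> x Lx; apply: ideal_addl; first exact: ideal_principal.
  by apply: ideal_addl => //; apply: ideal_gen_ideal.
apply: ideal_gen_sub => // _ [i /= ik <-].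
have [ij|ij] := ltnP i (k - j.+1)%N.
  apply: ideal_addl; first exact: ideal_principal.
  by apply: ideal_add_inr => //; apply: sub_ideal_gen; exists i.
apply: ideal_add_inr => //; exists 1 => //; rewrite mul1r; congr g.
by apply: val_inj => /=; lia.
Qed.

(** Gaussian elimination over the residue field, with coefficients lifted to R: PA indexes the
    unknowns and PB the equations. *)
Lemma residue_dependence (A B : finType) (PA : {set A}) (PB : {set B})
    (M : A -> B -> R) : (#|PB| < #|PA|)%N ->
  exists c : A -> R, [/\ exists2 a, a \in PA & c a \notin m,
    forall a, a \notin PA -> c a = 0 &
    forall b, b \in PB -> \sum_(a in PA) c a * M a b \in m].
Proof.
have [k kB] := ubnP #|PB|; elim: k => // k IH in PA PB M kB *.
move=> BA; have [PB0|[b bPB]] := set_0Vmem PB.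
  have [a aPA] : exists a, a \in PA by apply/card_gt0P; lia.
  exists (fun a' => (a' == a)%:R); split.
  - by exists a; rewrite // eqxx idealr1.
  - by move=> a' a'PA; case: eqP => // E; rewrite E aPA in a'PA.
  - by move=> b; rewrite PB0 inE.
have cB := cardsD1 b PB; rewrite bPB in cB.
have [/existsP[a0 /andP[a0PA ua0]]|/existsPn Mm] :=
  boolP [exists a, (a \in PA) && (M a b \notin m)].
  have [y Ey] := local_unit ua0.
  have cA := cardsD1 a0 PA; rewrite a0PA in cA.
  have [|| c [[a1 a1PA ua1] c0 cM]] := IH (PA :\ a0) (PB :\ b)
    (fun a b' => M a b' - M a b * y * M a0 b'); rewrite ?in_setD1; try lia.
  (* The coefficient of the pivot a0 makes equation b hold exactly, because y inverts [M a0 b]. *)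
  pose c' a := if a == a0 then - \sum_(a in PA :\ a0) c a * M a b * y else c a.
  have sumE b' : \sum_(a in PA) c' a * M a b' =
      \sum_(a in PA :\ a0) c a * (M a b' - M a b * y * M a0 b').
    rewrite (big_setD1 a0) //= /c' eqxx mulNr mulr_suml -sumrN -big_split /=.
    apply: eq_bigr => a; rewrite !inE => /andP[/negPf -> _].
    by ring.
  exists c'; split.
  - exists a1; first by move: a1PA; rewrite !inE => /andP[].
    by rewrite /c'; move: a1PA; rewrite !inE => /andP[/negPf -> _].
  - move=> a aPA; rewrite /c'; case: eqP => [E|_].
      by rewrite E a0PA in aPA.
    by apply: c0; rewrite !inE (negPf aPA) andbF.
  - move=> b' b'PB; rewrite sumE; have [->|b'b] := eqVneq b' b.
      rewrite big1 ?idealr0 // => a _.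
      by rewrite -mulrA Ey mulr1 subrr mulr0.
    by apply: cM; rewrite !inE b'b.
have [||c [c1 c0 cM]] := IH PA (PB :\ b) M; try lia.
exists c; split=> // b' b'PB; have [->|b'b] := eqVneq b' b.
  apply: rpred_sum => a aPA; apply: idealMr.
  by have := Mm a; rewrite aPA /= negbK.
by apply: cM; rewrite !inE b'b.
Qed.

End LocalRing.

(** * Monomials and their degrees *)

Section Monomials.
Variables (F : comNzRingType) (d : nat) (x : 'I_d -> F).
Implicit Types u v : 'I_d -> nat.

Definition mon u := \prod_i x i ^+ u i.

Definition mdeg u := (\sum_i u i)%N.

Lemma monD u v : mon (fun i => u i + v i)%N = mon u * mon v.
Proof. by rewrite -big_split; apply: eq_bigr => i _; rewrite exprD. Qed.

Lemma mon0 : mon (fun=> 0%N) = 1.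
Proof. by rewrite /mon big1. Qed.

Lemma mon_delta i : mon (fun j => j == i)%N = x i.
Proof.
rewrite /mon (bigD1 i) //= eqxx expr1 big1 ?mulr1 // => j /negPf ->.
by rewrite expr0.
Qed.

Lemma mdegD u v : mdeg (fun i => u i + v i)%N = (mdeg u + mdeg v)%N.
Proof. by rewrite /mdeg big_split. Qed.

Lemma mdeg0 : mdeg (fun=> 0%N) = 0%N.
Proof. by rewrite /mdeg big1. Qed.

Lemma mdeg_delta i : mdeg (fun j => j == i)%N = 1%N.
Proof. by rewrite /mdeg (bigD1 i) //= eqxx big1 // => j /negPf ->. Qed.

Lemma mon_ideal_exp (I : set F) u :
  (forall i, I (x i)) -> ideal_exp I (mdeg u) (mon u).
Proof.
move=> Ix; rewrite /mdeg /mon.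
elim/big_rec2: _ => // i k y _ H; apply: ideal_expM => //.
elim: (u i) => // n IH; rewrite exprS; exact: ideal_mulP.
Qed.

End Monomials.

(** * Points where a polynomial is nonzero over the residue field *)

Section ResidueNonvanishing.
Variables (R : comNzRingType) (m : idealr R).
Hypothesis Rlocal : local_ring m.

(** The values at the points e are the coefficient vector times a Vandermonde matrix whose
    determinant is a unit. If all values were in m, the adjugate would put det V times [g k] in
    m. *)
Lemma residue_nonvanishing1 L (e : 'I_L -> R) (g : 'I_L -> R) :
  (forall i j : 'I_L, i != j -> e i - e j \notin m) ->
  (exists k, g k \notin m) -> exists l, \sum_k g k * e l ^+ k \notin m.
Proof.
move=> ue [k gk]; apply: contrapT => /forallNP nl.
have {}nl l : \sum_k g k * e l ^+ k \in m by apply/negPn/negP.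
pose V := Vandermonde L (\row_j e j).
have uV : \det V \notin m.
  rewrite det_Vandermonde; apply: (local_prodN Rlocal) => i _.
  apply: (local_prodN Rlocal) => j ij; rewrite !mxE; apply: ue.
  by rewrite eq_sym; move: ij; apply: contraTneq => ->; rewrite ltnn.
have /negP := local_mulN Rlocal uV gk; apply.
have -> : \det V * g k = ((\row_j g j) *m V *m \adj V) 0 k.
  by rewrite -mulmxA mul_mx_adj mul_mx_scalar !mxE.
rewrite mxE; apply: rpred_sum => l _; rewrite mulrC; apply: idealMr.
by rewrite mxE; under eq_bigr do rewrite !mxE.
Qed.

(** The coordinates are specialised one at a time. After k steps, some monomial in the remaining
    variables, the one given by u from coordinate k on, still has a coefficient outside m, and
    [residue_nonvanishing1] chooses the next coordinate. *)
Lemma residue_nonvanishing d L (e : 'I_L -> R) (c : {ffun 'I_d -> 'I_L} -> R) :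
  (forall i j : 'I_L, i != j -> e i - e j \notin m) ->
  (exists u, c u \notin m) ->
  exists l : 'I_d -> R, \sum_u c u * mon l (fun i => u i) \notin m.
Proof.
move=> ue [u0 cu0].
pose agree (k : nat) (u v : {ffun 'I_d -> 'I_L}) :=
  [forall i : 'I_d, (k <= i)%N ==> (v i == u i)].
suff H k : (k <= d)%N -> exists (l : 'I_d -> R) u,
    \sum_(v | agree k u v) c v * \prod_(i < d | (i < k)%N) l i ^+ v i \notin m.
  have [l [u lu]] := H d (leqnn d); exists l.
  rewrite (eq_bigr (fun v : {ffun 'I_d -> 'I_L} => c v * \prod_(i < d | (i < d)%N) l i ^+ v i)).
    rewrite (eq_bigl (agree d u)) // => v.
    by apply/esym/forallP => i; rewrite leqNgt ltn_ord.
  by move=> v _; congr (_ * _); apply: eq_bigl => i; rewrite ltn_ord.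
elim: k => [|k IH] kd.
  exists (fun=> 0), u0; rewrite (big_pred1 u0) ?big_pred0 ?mulr1 //.
  move=> v; apply/forallP/eqP => [E|-> i]; last by rewrite eqxx implybT.
  by apply/ffunP => i; apply/eqP; have := E i.
have [l [u lu]] := IH (ltnW kd).
pose ik := Ordinal kd.
(* [g j] is the coefficient of the j-th power of the next variable. *)
pose g (j : 'I_L) :=
  \sum_(v | agree k.+1 u v && (v ik == j)) c v * \prod_(i < d | (i < k)%N) l i ^+ v i.
have agreeE v : agree k.+1 u v && (v ik == u ik) = agree k u v.
  apply/andP/forallP => [[/forallP H /eqP E] i|H].
    apply/implyP; rewrite leq_eqVlt => /orP[/eqP ki|]; last exact/implyP.
    by have -> : i = ik by [apply: val_inj]; rewrite E.
  split; last by have := H ik; rewrite leqnn.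
  by apply/forallP => i; apply/implyP => /ltnW; apply/implyP.
have [|p gp] := residue_nonvanishing1 ue (g := g).
  by exists (u ik); rewrite /g (eq_bigl _ _ agreeE).
exists (fun i => if i == ik then e p else l i), u.
rewrite (partition_big (fun v : {ffun 'I_d -> 'I_L} => v ik) predT) //=.
rewrite (eq_bigr (fun j => g j * e p ^+ j)) // => j _.
rewrite /g mulr_suml; apply: eq_bigr => v /andP[_ /eqP vj].
rewrite (bigD1 ik) //= eqxx vj -mulrA [e p ^+ _ * _]mulrC; congr (_ * (_ * _)).
apply: eq_big => [i|i /andP[_ /negPf -> //]].
rewrite ltnS andbC ltn_neqAle; congr (_ && _).
Qed.

End ResidueNonvanishing.

(** * Chains of primes exclude algebraic relations *)

Section ChainRelation.
Variables (R F : comNzRingType) (m : idealr R) (phi : {rmorphism R -> F}).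
Hypothesis phim : forall a, a \in m -> phi a = 0.
Hypothesis Rlocal : local_ring m.

(** The relation is reduced along the chain. At stage k it is divided by the least power of y_k with
    a coefficient outside m, which is allowed because y_k is not in the prime P_k; terms still
    containing y_k then vanish modulo P_(k+1). In the end a unit lies in P_d. *)
Lemma prime_chain_no_relation d N (P : nat -> prime_idealr F) (y : 'I_d -> F)
    (c : {ffun 'I_d -> 'I_N} -> R) :
  (forall i : 'I_d, {subset P i <= P i.+1}) ->
  (forall i : 'I_d, y i \in P i.+1) -> (forall i : 'I_d, y i \notin P i) ->
  (exists u, c u \notin m) ->
  \sum_u phi (c u) * mon y (fun i => u i) <> 0.
Proof.
move=> sP yP yNP [u0 cu0] E.
pose agree (k : nat) (u v : {ffun 'I_d -> 'I_N}) :=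
  [forall i : 'I_d, (i < k)%N ==> (v i == u i)].
pose tail (k : nat) (v : {ffun 'I_d -> 'I_N}) := \prod_(i < d | (k <= i)%N) y i ^+ v i.
suff H k : (k <= d)%N -> exists2 u, c u \notin m &
    \sum_(v | agree k u v) phi (c v) * tail k v \in P k.
  have [u cu] := H d (leqnn d); rewrite (big_pred1 u); last first.
    move=> v; apply/forallP/eqP => [Ev|-> i]; last by rewrite eqxx implybT.
    by apply/ffunP => i; apply/eqP; have := Ev i; rewrite ltn_ord.
  rewrite /tail big_pred0 ?mulr1; last by move=> i; rewrite leqNgt ltn_ord.
  have [z zc] := local_unit Rlocal cu; move/(idealMr (phi z)).
  by rewrite -rmorphM zc rmorph1 idealr1.
elim: k => [|k IH] kd.
  exists u0 => //; rewrite (eq_bigl predT) /tail /=.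
    by have -> := E; rewrite idealr0.
  by move=> v; apply/forallP.
have [u cu Pu] := IH (ltnW kd).
pose ik := Ordinal kd.
pose Q := [pred v | agree k u v && (c v \notin m)].
have Qu : Q u.
  by rewrite /= cu andbT; apply/forallP => i; rewrite eqxx implybT.
have [u1 /andP[agu1 cu1] u1min] :=
  arg_minnP (P := Q) (fun v : {ffun 'I_d -> 'I_N} => v ik : nat) Qu.
have agreeE v : agree k.+1 u1 v = agree k u v && (v ik == u1 ik).
  apply/forallP/andP => [H|[/forallP H /eqP Ek] i].
    split; last by have := H ik; rewrite leqnn.
    apply/forallP => i; apply/implyP => ki.
    have /implyP := H i; rewrite ltnS (ltnW ki) => /(_ isT) /eqP ->.
    by move/forallP: agu1 => /(_ i)/implyP; apply.
  rewrite ltnS leq_eqVlt; apply/implyP => /orP[/eqP ki|ki].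
    by have -> : i = ik by [apply: val_inj]; rewrite Ek.
  have /implyP/(_ ki)/eqP -> := H i.
  by rewrite eq_sym; move/forallP: agu1 => /(_ i)/implyP; apply.
have tailE v : tail k v = y ik ^+ v ik * tail k.+1 v.
  rewrite /tail (bigD1 ik) //=; congr (_ * _); apply: eq_bigl => i.
  by rewrite [RHS]ltn_neqAle andbC eq_sym.
(* The truncated subtraction is exact where [c v] is outside m, by the choice of u1; all other terms
   vanish under phi. *)
have sumE : \sum_(v | agree k u v) phi (c v) * tail k v =
    y ik ^+ u1 ik * \sum_(v | agree k u v) phi (c v) * (y ik ^+ (v ik - u1 ik) * tail k.+1 v).
  rewrite mulr_sumr; apply: eq_bigr => v av; rewrite tailE.
  have [cv|cv] := boolP (c v \in m); first by rewrite phim // !mul0r mulr0.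
  rewrite [RHS]mulrCA; congr (_ * _); rewrite mulrA -exprD subnKC //.
  by apply: u1min; rewrite /= av.
exists u1 => //.
have Pyk n : (y ik ^+ n \in P k) = false.
  elim: n => [|n IHn]; first by rewrite expr0 idealr1.
  by rewrite exprS prime_idealrM IHn (negPf (yNP ik)).
move: Pu; rewrite sumE prime_idealrM Pyk /= => /(sP ik).
rewrite (bigID (fun v : {ffun 'I_d -> 'I_N} => v ik == u1 ik)) /=.
set B := (X in _ + X \in _) => Pu.
have PB : B \in P k.+1.
  apply: rpred_sum => v /andP[av vk].
  have [cv|cv] := boolP (c v \in m); first by rewrite phim // mul0r idealr0.
  apply: idealMr; rewrite mulrC; apply: idealMr.
  have : (u1 ik <= v ik)%N by apply: u1min; rewrite /= av.
  rewrite leq_eqVlt eq_sym -val_eqE in vk *; rewrite (negPf vk) /= -subn_gt0.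
  by case: (_ - _)%N => // n _; rewrite exprSr; apply: idealMr; apply: yP.
have := rpredB Pu PB; rewrite addrK (eq_bigl _ _ agreeE).
rewrite (eq_bigr (fun v => phi (c v) * tail k.+1 v)) // => v /andP[_ /eqP ->].
by rewrite subnn mul1r.
Qed.

End ChainRelation.

(** * Krull dimension through boundary monoids *)

Definition exp_step (n : nat -> nat) (i j : nat) : nat :=
  if (j < i)%N then n j else if j == i then (n i).+1 else 0%N.

Section BoundaryMonoid.
Variable F : comNzRingType.

(** The iterated boundary monoid of Coquand and Lombardi. That 0 belongs to it is the nested
    relation between the elements of s. *)
Fixpoint boundary_monoid (s : seq F) : set F :=
  if s is x :: s' then
    [set z | exists n a w, boundary_monoid s' w /\ z = x ^+ n * (w + a * x)]
  else [set 1].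

Lemma boundary_monoid1 s : boundary_monoid s 1.
Proof.
elim: s => //= x s IH; exists 0%N, 0, 1; split=> //.
by rewrite mul0r addr0 mulr1.
Qed.

Lemma boundary_monoidM s x y :
  boundary_monoid s x -> boundary_monoid s y -> boundary_monoid s (x * y).
Proof.
elim: s x y => [|z s IH] x y /=; first by move=> -> ->; rewrite mulr1.
move=> [n [a [w [sw ->]]]] [n' [a' [w' [sw' ->]]]].
exists (n + n')%N, (w * a' + a * w' + a * a' * z), (w * w'); split.
  exact: IH.
by rewrite exprD; ring.
Qed.

(** Let p be a prime containing Q and missing the monoid of x :: s. It does not contain x, which is
    in that monoid. Moreover p + (x) misses the monoid of s, since a + b x there would put a = (a +
    b x) - b x in the larger monoid; so the chain continues above p + (x). *)
Lemma boundary_monoid_chain s (Q : set F) : is_ideal Q ->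
  (forall x, Q x -> ~ boundary_monoid s x) ->
  exists P : nat -> prime_idealr F, (forall x, Q x -> x \in P 0%N) /\
    forall i, (i < size s)%N ->
      [/\ {subset P i <= P i.+1}, nth 0 s i \in P i.+1 & nth 0 s i \notin P i].
Proof.
elim: s Q => [|x s IH] Q iQ QS.
  have [p [Qp _]] := prime_avoiding_monoid iQ (boundary_monoid1 [::])
    (@boundary_monoidM [::]) QS.
  by exists (fun=> p).
have [p [Qp pS]] := prime_avoiding_monoid iQ (boundary_monoid1 _)
    (@boundary_monoidM _) QS.
have ip := idealr_is_ideal p.
have ipx := ideal_add_ideal ip (ideal_principal x).
have [|P [PQ Ps]] := IH _ ipx.
  move=> _ [a [_ [/= pa [b _ <-] ->]]] Sab; apply: (pS a) => //.
  exists 0%N, (- b), (a + b * x); split=> //.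
  by rewrite mul1r mulNr addrK.
exists (fun i => if i is i'.+1 then P i' else p); split=> // -[_|i].
  split=> /=.
  - by move=> y py; apply/PQ/ideal_addl => //; apply: ideal_principal.
  - by apply/PQ/ideal_add_inr => //; exists 1; rewrite ?mul1r.
  - apply/negP => /pS; apply; exists 1%N, 0, 1; split.
      exact: boundary_monoid1.
    by rewrite expr1 mul0r addr0 mulr1.
exact: Ps.
Qed.

(** Multiplying out the nested product, the term of a_i has the exponents [exp_step n i]: those of n
    before i, one more at i, none after i. They are lexicographically larger than n. *)
Lemma boundary_monoid_expand s w : boundary_monoid s w ->
  exists (n : nat -> nat) (a : nat -> F),
    w = \prod_(i < size s) nth 0 s i ^+ n i +
        \sum_(i < size s) a i * \prod_(j < size s) nth 0 s j ^+ exp_step n i j.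
Proof.
elim: s w => [|x s IH] w /=.
  by move=> ->; exists (fun=> 0%N), (fun=> 0); rewrite !big_ord0 addr0.
move=> [k [b [_ [/IH[n [a ->]] ->]]]].
exists (fun i => if i is i'.+1 then n i' else k).
exists (fun i => if i is i'.+1 then a i' else b).
rewrite !big_ord_recl /= [X in _ + (b * (_ * X) + _)]big1 ?mulr1 //.
rewrite !mulrDr -addrA; congr (_ + _); rewrite addrC; congr (_ + _).
  by rewrite /exp_step /= exprSr; ring.
rewrite mulr_sumr; apply: eq_bigr => i _; rewrite big_ord_recl /= mulrCA.
by congr (_ * (_ * _)).
Qed.

(** If 0 were not in the boundary monoid of the x_i, [boundary_monoid_chain] applied to the zero
    ideal would produce a chain of d + 1 primes. *)
Lemma krull_dim_relation d (x : 'I_d -> F) :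
  (forall P : 'I_d.+1 -> prime_idealr F, ~ prime_chain P) ->
  exists (n : nat -> nat) (a : nat -> F),
    mon x (fun i => n i) + \sum_(i < d) a i * mon x (fun j => exp_step n i j) = 0.
Proof.
move=> noP; pose s := [seq x i | i <- enum 'I_d].
have ss : size s = d by rewrite size_map size_enum_ord.
have nths (i : 'I_d) : nth 0 s i = x i.
  by rewrite (nth_map i) ?size_enum_ord // nth_ord_enum.
have [S0|nS0] := pselect (boundary_monoid s 0); last first.
  have i0 : is_ideal [set (0 : F)].
    split=> //= [_ _ -> ->|a _ ->]; first by rewrite addr0.
    by rewrite mulr0.
  have [|P [_ Ps]] := boundary_monoid_chain i0 (s := s); first by move=> _ ->.
  case: (noP (fun i => P i)) => i j ij.
  have sP (k l : nat) : (k + l <= d)%N -> {subset P k <= P (k + l)%N}.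
    elim: l => [|l IHl] kl; first by rewrite addn0.
    move=> y Py; rewrite addnS.
    have [|sub _ _] := Ps (k + l)%N; first by rewrite ss; lia.
    by apply/sub/IHl => //; lia.
  have jd := ltn_ord j.
  have [|sub iP iNP] := Ps i; first by rewrite ss; lia.
  have sub' : {subset P i.+1 <= P j}.
    by have := sP i.+1 (j - i.+1)%N; rewrite subnKC //; apply; lia.
  split; first by move=> y /sub/sub'.
  by move=> /(_ _ (sub' _ iP)); apply/negP.
have [n [a E]] := boundary_monoid_expand S0; exists n, a.
have monE u : mon x (fun i => u (i : nat)) = \prod_(i < size s) nth 0 s i ^+ u i.
  by rewrite ss; apply: eq_bigr => i _; rewrite nths.
rewrite [RHS]E monE; congr (_ + _); rewrite [in RHS]ss.
by apply: eq_bigr => i _; rewrite (monE (exp_step n i)) ss.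
Qed.

End BoundaryMonoid.

(** * Finite modules over a subalgebra with d generators *)

Lemma card_ffun_ord d N : #|[set: {ffun 'I_d -> 'I_N}]%SET| = (N ^ d)%N.
Proof. by rewrite cardsT card_ffun !card_ord. Qed.

Section FiniteModule.
Variables (R F : comNzRingType) (m : idealr R) (phi : {rmorphism R -> F}).
Hypothesis phim : forall a, a \in m -> phi a = 0.
Hypothesis Rlocal : local_ring m.

Definition lspan (G : set F) : set F :=
  [set y | exists k (c : 'I_k -> R) (g : 'I_k -> F),
     (forall i, G (g i)) /\ y = \sum_(i < k) phi (c i) * g i].

Lemma lspan0 G : lspan G 0.
Proof. by exists 0%N, (fun=> 0), (fun=> 0); split=> [[]//|]; rewrite big_ord0. Qed.

Lemma lspanD G x y : lspan G x -> lspan G y -> lspan G (x + y).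
Proof.
move=> [k [c [g [Sg ->]]]] [k' [c' [g' [Sg' ->]]]].
exists (k + k')%N.
exists (fun i => match fintype.split i with inl i => c i | inr i => c' i end).
exists (fun i => match fintype.split i with inl i => g i | inr i => g' i end).
split=> [i|]; first by case: (fintype.split i).
rewrite big_split_ord /=; congr (_ + _); apply: eq_bigr => i _.
  by rewrite (unsplitK (inl i)).
by rewrite (unsplitK (inr i)).
Qed.

Lemma lspanZ G a x : lspan G x -> lspan G (phi a * x).
Proof.
move=> [k [c [g [Sg ->]]]]; exists k, (fun i => a * c i), g.
by split=> //; rewrite mulr_sumr; apply: eq_bigr => i _; rewrite rmorphM mulrA.
Qed.

Lemma sub_lspan G : G `<=` lspan G.
Proof.
move=> x Sx; exists 1%N, (fun=> 1), (fun=> x).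
by split=> //; rewrite big_ord1 rmorph1 mul1r.
Qed.

Lemma lspan_sum G (T : Type) (r : seq T) (P : pred T) (f : T -> F) :
  (forall i, P i -> lspan G (f i)) -> lspan G (\sum_(i <- r | P i) f i).
Proof.
move=> H; elim/big_ind: _ => //; first exact: lspan0.
exact: lspanD.
Qed.

Lemma lspan_sub G G' : G `<=` lspan G' -> lspan G `<=` lspan G'.
Proof.
move=> GG' _ [k [c [g [Sg ->]]]]; apply: lspan_sum => i _.
by apply: lspanZ; apply: GG'.
Qed.

Lemma lspanM G G' H : (forall x y, G x -> G' y -> lspan H (x * y)) ->
  forall x y, lspan G x -> lspan G' y -> lspan H (x * y).
Proof.
move=> GG' _ _ [k [c [g [Sg ->]]]] [k' [c' [g' [Sg' ->]]]].
rewrite mulr_suml; apply: lspan_sum => i _; rewrite mulr_sumr.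
apply: lspan_sum => j _; rewrite mulrACA -rmorphM.
by apply: lspanZ; apply: GG'.
Qed.

Lemma lspan_finP (B : finType) (g : B -> F) y :
  lspan (range g) y -> exists c : B -> R, y = \sum_b phi (c b) * g b.
Proof.
move=> [k [c [f [Sf ->]]]].
have /choice[b bE] : forall i, exists b, g b = f i.
  by move=> i; have [b _ E] := Sf i; exists b.
exists (fun b' => \sum_(i | b i == b') c i).
rewrite (partition_big b predT) //=; apply: eq_bigr => b' _.
by rewrite rmorph_sum mulr_suml; apply: eq_bigr => i /eqP <-; rewrite bE.
Qed.

Variables (d : nat) (x : 'I_d -> F) (K : finType) (W : K -> F).

(** A filtration with polynomial growth: [S D] is spanned by D^d #|K| elements. *)
Let S (D : nat) : set F := lspan (range
  (fun p : {ffun 'I_d -> 'I_D} * K => mon x (fun i => p.1 i) * W p.2)).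

Let S_mon D (u : 'I_d -> nat) w : (forall i, (u i < D)%N) -> S D (mon x u * W w).
Proof.
move=> uD; apply: sub_lspan.
exists ([ffun i => Ordinal (uD i)], w) => //=; congr (_ * _).
by apply: eq_bigr => i _; rewrite ffunE.
Qed.

Let S_mono D E : (D <= E)%N -> S D `<=` S E.
Proof.
move=> DE; apply: lspan_sub => _ [[u w] _ <-] /=; apply: S_mon => i.
exact: leq_trans DE.
Qed.

Let lspan_S y : lspan [set z | exists u w, z = mon x u * W w] y ->
  exists D, S D y.
Proof.
move=> [k [c [g [Sg ->]]]].
have /choice[u uP] : forall i, exists u, exists w, g i = mon x u * W w by [].
exists (\max_i \max_j u i j).+1; apply: lspan_sum => i _; apply: lspanZ.
have [w ->] := uP i; apply: S_mon => j; rewrite ltnS.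
apply: leq_trans (leq_bigmax i); exact: leq_bigmax.
Qed.

(** If e > d, choose y_i in P_(i+1) \ P_i for i <= d. The N^(d+1) monomials in the y_i with
    exponents below N lie in a level [S E] with E linear in N, so for large N they are dependent,
    against [prime_chain_no_relation]. *)
Lemma finite_module_chain_bound :
  (forall y, lspan [set z | exists u w, z = mon x u * W w] y) ->
  forall e (P : 'I_e.+1 -> prime_idealr F), prime_chain P -> (e <= d)%N.
Proof.
move=> spanG e P chP; have spanF y := lspan_S (spanG y).
rewrite leqNgt; apply/negP => de.
(* Only indices up to d + 1 <= e are used, and there [inord] keeps its argument. *)
pose Q i := P (inord i).
have QS (i : 'I_d.+1) : {subset Q i <= Q i.+1} /\ ~ {subset Q i.+1 <= Q i}.
  by have id := ltn_ord i; apply: chP; rewrite !inordK; lia.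
have /choice[y yP] : forall i : 'I_d.+1, exists y, y \in Q i.+1 /\ y \notin Q i.
  move=> i; have [_ nsub] := QS i; apply: contrapT => /forallNP ny.
  by apply: nsub => z Qz; apply/negPn/negP => nz; case: (ny z).
have /choice[D DP] := spanF.
(* The level D1 contains 1, every y_i and every product of two module generators, so that
   multiplication by y_i raises the level by at most 2 D1. *)
pose D1 := (D 1%R + \max_i D (y i) + \max_p D (W p.1 * W p.2)%R)%N.
have S1 : S D1 1 by apply: S_mono (DP _); rewrite /D1 -addnA leq_addr.
have Sy i : S D1 (y i).
  apply: S_mono (DP _); rewrite /D1.
  have : (D (y i) <= \max_i D (y i))%N by exact: leq_bigmax.
  by move/leq_trans; apply; rewrite addnAC leq_addl.
have SW w w' : S D1 (W w * W w').
  apply: S_mono (DP _); rewrite /D1.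
  have : (D (W w * W w')%R <= \max_p D (W p.1 * W p.2)%R)%N.
    exact: (leq_bigmax (F := fun p : K * K => D (W p.1 * W p.2)) (w, w')).
  by move/leq_trans; apply; apply: leq_addl.
have SM A z i : S A z -> S (A + 2 * D1)%N (z * y i).
  move=> Az; apply: lspanM Az (Sy i) => _ _ [[u w] _ <-] [[u' w'] _ <-] /=.
  rewrite mulrACA -monD.
  apply: (lspanM (G := [set mon x (fun i => u i + u' i)%N]) _ _ (SW w w')).
    move=> _ _ -> [[u'' w''] _ <-] /=; rewrite mulrA -monD; apply: S_mon => j.
    have := ltn_ord (u j); have := ltn_ord (u' j); have := ltn_ord (u'' j).
    lia.
  exact: sub_lspan.
have SX A z i k : S A z -> S (A + 2 * D1 * k)%N (z * y i ^+ k).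
  move=> Az; elim: k => [|k IH]; first by rewrite muln0 addn0 mulr1.
  by rewrite exprSr mulrA mulnSr addnA; apply: SM.
have Smon (u : 'I_d.+1 -> nat) : S (D1 + 2 * D1 * mdeg u)%N (mon y u).
  rewrite /mon /mdeg -[X in S _ X]mul1r.
  suff H (r : seq 'I_d.+1) A z : S A z ->
      S (A + 2 * D1 * \sum_(i <- r) u i)%N (z * \prod_(i <- r) y i ^+ u i).
    exact: H.
  elim: r A z => [|i r IH] A z Az.
    by rewrite !big_nil muln0 addn0 mulr1.
  by rewrite !big_cons mulrA mulnDr addnA; apply: IH; apply: SX.
(* The level E = C N contains all monomials with exponents below N, and N > C^d #|K| gives N^(d+1) >
   E^d #|K|. *)
pose C := (D1 + 2 * D1 * d.+1)%N.
pose N := (C ^ d * #|K|).+1.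
pose E := (C * N)%N.
have SE (u : {ffun 'I_d.+1 -> 'I_N}) : S E (mon y (fun i => u i)).
  apply: S_mono (Smon _).
  have : (mdeg (fun i => u i) <= d.+1 * N)%N.
    rewrite /mdeg -[X in (_ <= X * _)%N]card_ord -sum_nat_const.
    by apply: leq_sum => i _; apply: ltnW.
  rewrite /E /C; have : (0 < N)%N by [].
  move: (mdeg _) => M; nia.
have /choice[A AE] : forall u : {ffun 'I_d.+1 -> 'I_N},
    exists c : {ffun 'I_d -> 'I_E} * K -> R,
    mon y (fun i => u i) = \sum_b phi (c b) * (mon x (fun i => b.1 i) * W b.2).
  by move=> u; apply: lspan_finP (SE u).
have [|c [[u _ cu] _ cA]] := residue_dependence Rlocal
    (PA := [set: {ffun 'I_d.+1 -> 'I_N}]%SET)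
    (PB := [set: {ffun 'I_d -> 'I_E} * K]%SET) A.
  rewrite card_ffun_ord cardsT card_prod card_ffun !card_ord /E expnMn expnS.
  have : (0 < N ^ d)%N by rewrite expn_gt0.
  rewrite {3}/N; nia.
apply: (@prime_chain_no_relation R F m phi phim Rlocal d.+1 N Q y c).
- by move=> i; case: (QS i).
- by move=> i; case: (yP i).
- by move=> i; case: (yP i).
- by exists u.
under eq_bigr do rewrite AE mulr_sumr.
rewrite exchange_big /= big1 // => b _.
under eq_bigr do rewrite mulrA -rmorphM.
rewrite -mulr_suml -rmorph_sum phim ?mul0r //.
by have := cA b (finset.in_setT _); rewrite (eq_bigl predT) // => u'; rewrite inE.
Qed.

End FiniteModule.

(** * Powers of I in terms of generators of a reduction *)

Section ReductionSpan.
Variables (R : comNzRingType) (I J : set R) (r : nat).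
Hypothesis JI : ideal_exp I r.+1 = ideal_mul J (ideal_exp I r).

Lemma reduction_exp e :
  ideal_exp I (r + e).+1 `<=` ideal_mul J (ideal_exp I (r + e)).
Proof.
elim: e => [|e IH]; first by rewrite addn0 JI.
rewrite addnS /=; apply: ideal_mul_sub => [|a b Ia /IH].
  exact: ideal_mul_ideal.
rewrite mulrC; apply: ideal_mul_gen_mulr => [|j c Jj Ic]; first exact: ideal_mul_ideal.
by rewrite -mulrA; apply: ideal_mulP => //; rewrite mulrC; apply: ideal_mulP.
Qed.

(** Iterating [reduction_exp] puts I^(r+e) inside J^e I^r, written here on generators. *)
Lemma reduction_span (d : nat) (x : 'I_d -> R) (K : finType) (W : K -> R) e :
  generates x J -> ideal_exp I r = ideal_gen (range W) ->
  ideal_exp I (r + e) `<=`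
    ideal_gen [set z | exists u w, mdeg u = e /\ z = mon x u * W w].
Proof.
move=> xJ WI; elim: e => [|e IH].
  rewrite addn0 WI; apply: ideal_gen_sub => [|_ [w _ <-]].
    exact: ideal_gen_ideal.
  apply: sub_ideal_gen; exists (fun=> 0%N), w.
  by rewrite mdeg0 mon0 mul1r.
rewrite addnS; apply: (subset_trans (@reduction_exp e)).
have iG := ideal_gen_ideal
  [set z | exists (u : 'I_d -> nat) w, mdeg u = e.+1 /\ z = mon x u * W w].
apply: ideal_mul_sub => // j b; rewrite -xJ => Jj /IH Ib; rewrite mulrC.
apply: ideal_gen_mulr Ib => // _ [u [w [ue ->]]]; rewrite mulrC.
apply: ideal_gen_mulr Jj => // _ [i _ <-]; apply: sub_ideal_gen.
exists (fun j => (j == i) + u j)%N, w; rewrite monD mon_delta mulrA.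
by rewrite mdegD mdeg_delta ue.
Qed.

End ReductionSpan.

(** * Homogeneous elements of the Rees algebra *)

Section ReesHomogeneous.
Variables (R : comNzRingType) (I : set R).

(** The element c t^k, with default value 0 when c is not in I^k. *)
Definition rees_hom (k : nat) (c : R) : rees I := insubd 0 (c *: 'X^k).

Lemma rees_homE k c : ideal_exp I k c -> val (rees_hom k c) = c *: 'X^k.
Proof.
move=> Ic; apply: insubdK; apply/rees_predP => i.
rewrite coefZ coefXn; case: eqP => [->|_]; rewrite ?mulr1 //.
by rewrite mulr0; apply: ideal_zero; apply: ideal_exp_ideal.
Qed.

Definition reesC (a : R) : rees I := rees_hom 0 a.

Lemma val_reesC a : val (reesC a) = a%:P.
Proof. by rewrite rees_homE // expr0 alg_polyC. Qed.

Lemma reesC_is_zmod_morphism : zmod_morphism reesC.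
Proof. by move=> a b; apply: val_inj; rewrite rmorphB /= !val_reesC polyCB. Qed.

Lemma reesC_is_monoid_morphism : monoid_morphism reesC.
Proof.
split=> [|a b]; apply: val_inj; rewrite ?rmorph1 ?rmorphM /= !val_reesC //.
by rewrite polyCM.
Qed.

HB.instance Definition _ :=
  GRing.isZmodMorphism.Build R (rees I) reesC reesC_is_zmod_morphism.
HB.instance Definition _ :=
  GRing.isMonoidMorphism.Build R (rees I) reesC reesC_is_monoid_morphism.

Lemma rees_homD k a b : ideal_exp I k a -> ideal_exp I k b ->
  rees_hom k (a + b) = rees_hom k a + rees_hom k b.
Proof.
move=> Ia Ib; apply: val_inj; rewrite rmorphD /= !rees_homE ?scalerDl //.
by apply: ideal_addr => //; apply: ideal_exp_ideal.
Qed.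

Lemma rees_homZ k a b : ideal_exp I k b ->
  rees_hom k (a * b) = reesC a * rees_hom k b.
Proof.
move=> Ib; apply: val_inj; rewrite rmorphM /= val_reesC !rees_homE //.
  by rewrite mul_polyC scalerA.
by apply: ideal_mulr => //; apply: ideal_exp_ideal.
Qed.

Lemma rees_hom0 k : rees_hom k 0 = 0.
Proof.
apply: val_inj; rewrite rmorph0 /= rees_homE ?scale0r //.
by apply: ideal_zero; apply: ideal_exp_ideal.
Qed.

Lemma rees_sum_hom (p : rees I) :
  p = \sum_(k < size (val p)) rees_hom k (val p)`_k.
Proof.
apply: val_inj; rewrite rmorph_sum /=.
under eq_bigr => k _ do [rewrite rees_homE; last exact: (rees_predP _ _ (valP p))].
by rewrite -poly_def coefK.
Qed.

Lemma val_mon_hom d (x : 'I_d -> R) u : (forall i, I (x i)) ->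
  val (mon (fun i => rees_hom 1 (x i)) u) = mon x u *: 'X^(mdeg u).
Proof.
move=> Ix; rewrite /mon rmorph_prod.
rewrite (eq_bigr (fun i => x i ^+ u i *: 'X^(u i))); last first.
  move=> i _; rewrite rmorphXn /= [rees_val _]rees_homE ?exprZn //.
  exact: ideal_exp1.
rewrite scaler_prod; congr (_ *: _).
by rewrite /mdeg; elim/big_rec2: _ => // i a b _ ->; rewrite exprD.
Qed.

Lemma rees_hom_mon d (x : 'I_d -> R) u k w : (forall i, I (x i)) ->
  ideal_exp I k w ->
  rees_hom (k + mdeg u) (mon x u * w) =
    mon (fun i => rees_hom 1 (x i)) u * rees_hom k w.
Proof.
move=> Ix Iw; apply: val_inj; rewrite rmorphM /= val_mon_hom // !rees_homE //.
  by rewrite -scalerAl -scalerAr scalerA -exprD addnC.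
by rewrite addnC; apply: ideal_expM => //; apply: mon_ideal_exp.
Qed.

End ReesHomogeneous.

(** * Chains of primes in the special fiber ring *)

Section FiberChains.
Variables (R : comNzRingType) (m : idealr R) (I : set R).
Hypothesis Rlocal : local_ring m.

Let proj : rees I -> special_fiber m I := \pi_({ideal_quot (@fiber_ideal R m I)})%qT.

(** By [reduction_span], generators of I^0, ..., I^r span the special fiber as a module over the
    subalgebra generated by the classes of the x_i, so [finite_module_chain_bound] applies. *)
Lemma analytic_spread_le (J : set R) d (x : 'I_d -> R) e
    (P : 'I_e.+1 -> prime_idealr (special_fiber m I)) :
  noetherian R -> reduction I J -> generates x J -> prime_chain P -> (e <= d)%N.
Proof.
move=> Rnoeth [iJ sJI [r JI]] xJ.
have Ix i : I (x i) by apply: sJI; rewrite -xJ; apply: sub_ideal_gen; exists i.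
pose phi : {rmorphism R -> special_fiber m I} :=
  (\pi_({ideal_quot (@fiber_ideal R m I)})%qT : {rmorphism _ -> _}) \o @reesC R I.
have phim a : a \in m -> phi a = 0.
  move=> am; rewrite -[0](rmorph0 \pi_({ideal_quot (@fiber_ideal R m I)})%qT).
  apply/eqP/special_fiber_eqP => i; rewrite val_reesC coef0 subr0 coefC.
  case: i => [|i] /=; last by apply: ideal_zero; apply: ideal_mul_ideal.
  by rewrite -[a]mulr1; apply: ideal_mulP.
have /choice[G GP] : forall k, exists G : {n & 'I_n -> R},
    generates (projT2 G) (ideal_exp I k).
  move=> k; have [n [g gP]] := Rnoeth _ (ideal_exp_ideal I k).
  by exists (existT _ n g).
pose K : finType := {k : 'I_r.+1 & 'I_(projT1 (G k))}.
pose W (w : K) := proj (rees_hom I (tag w) (projT2 (G (tag w)) (tagged w))).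
apply: (@finite_module_chain_bound _ _ m phi phim Rlocal d
  (fun i => proj (rees_hom I 1 (x i))) K W).
set Gs := [set z | _].
have projE (y : special_fiber m I) : y = proj (repr y).
  by rewrite /proj; apply/esym; apply: reprK.
suff H k c : ideal_exp I k c -> lspan phi Gs (proj (rees_hom I k c)).
  move=> y; rewrite [y]projE (rees_sum_hom (repr y)) /proj rmorph_sum /=.
  apply: lspan_sum => k _; apply: H.
  exact: (rees_predP _ _ (valP (repr y))).
(* Membership in I^k is carried along because [rees_hom k] is additive on I^k. *)
pose C k := [set c | ideal_exp I k c /\ lspan phi Gs (proj (rees_hom I k c))].
have iC : is_ideal (C k).
  have iI := ideal_exp_ideal I k; split.
  - split; first exact: ideal_zero.
    by rewrite rees_hom0 /proj rmorph0; apply: lspan0.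
  - move=> a b [Ia La] [Ib Lb]; split; first exact: ideal_addr.
    by rewrite rees_homD // /proj rmorphD; apply: lspanD.
  - move=> a b [Ib Lb]; split; first exact: ideal_mulr.
    by rewrite rees_homZ // /proj rmorphM; apply: (lspanZ a Lb).
suff: ideal_exp I k `<=` C k by move=> H /H[].
have [kr|rk] := leqP k r.
  rewrite -{1}(GP k); apply: ideal_gen_sub => // _ [j _ <-]; split.
    by rewrite -(GP k); apply: sub_ideal_gen; exists j.
  apply: sub_lspan; exists (fun=> 0%N).
  by exists (Tagged (fun k : 'I_r.+1 => 'I_(projT1 (G k))) (i := Ordinal (kr : (k < r.+1)%N)) j);
    rewrite mon0 mul1r.
have kE : k = (r + (k - r))%N by lia.
rewrite {1}kE.
apply: (subset_trans (reduction_span JI xJ (esym (GP r)))).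
apply: ideal_gen_sub => // _ [u [w [ue ->]]].
have Iw : ideal_exp I r (projT2 (G r) w).
  by rewrite -(GP r); apply: sub_ideal_gen; exists w.
have kE' : k = (r + mdeg u)%N by rewrite ue.
split.
  by rewrite kE' addnC; apply: ideal_expM => //; apply: mon_ideal_exp.
rewrite kE' rees_hom_mon //; apply: sub_lspan; exists u.
exists (Tagged (fun k : 'I_r.+1 => 'I_(projT1 (G k))) (i := Ordinal (ltnSn r)) w).
by rewrite /proj rmorphM /= /mon rmorph_prod; under eq_bigr do rewrite rmorphXn.
Qed.

(** The relation of [krull_dim_relation] is read in the degree N of its leading monomial: of a_i
    only the component of degree N - D_i contributes, and nothing does when D_i > N. *)
Lemma analytic_spread_relation d (x : 'I_d -> R) :
  (forall P : 'I_d.+1 -> prime_idealr (special_fiber m I), ~ prime_chain P) ->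
  (forall i, I (x i)) ->
  exists (n : nat -> nat) (b : 'I_d -> R),
    let N := mdeg (fun i : 'I_d => n i) in
    let D (i : 'I_d) := mdeg (fun j : 'I_d => exp_step n i j) in
    (forall i, ideal_exp I (N - D i) (b i)) /\
    ideal_mul [set` m] (ideal_exp I N)
      (mon x (fun i => n i) +
       \sum_(i | (D i <= N)%N) b i * mon x (fun j => exp_step n i j)).
Proof.
move=> noP Ix.
have [n [a E]] := krull_dim_relation (fun i => proj (rees_hom I 1 (x i))) noP.
exists n; set N := mdeg _; pose D (i : 'I_d) := mdeg (fun j : 'I_d => exp_step n i j).
exists (fun i : 'I_d => (val (repr (a i)))`_(N - D i)); split=> /=.
  by move=> i; apply: (rees_predP _ _ (valP (repr (a i)))).
have monE u : mon (fun i => proj (rees_hom I 1 (x i))) u =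
    proj (mon (fun i => rees_hom I 1 (x i)) u).
  by rewrite /proj /mon rmorph_prod; under [RHS]eq_bigr do rewrite rmorphXn.
pose p := mon (fun i => rees_hom I 1 (x i)) (fun i => n i) +
  \sum_(i < d) repr (a i) * mon (fun i => rees_hom I 1 (x i)) (fun j => exp_step n i j).
have : proj p = proj 0.
  rewrite /proj rmorph0 rmorphD rmorph_sum /= -[RHS]E monE; congr (_ + _).
  by apply: eq_bigr => i _; rewrite rmorphM monE; congr (_ * _); apply: reprK.
move/eqP/special_fiber_eqP/(_ N); rewrite coef0 subr0.
rewrite [rees_val _](_ : _ = val p) // /p rmorphD rmorph_sum /= coefD val_mon_hom //.
rewrite coefZ coefXn eqxx mulr1 coef_sum.
congr (ideal_mul _ _ (_ + _)); rewrite [RHS]big_mkcond /=; apply: eq_bigr => i _.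
rewrite val_mon_hom // -scalerAr coefZ coefMXn ltnNge -/(D i).
by case: leqP => _; rewrite ?mulr0 // mulrC.
Qed.

End FiberChains.

(** * Counting exponent vectors *)

Section Counting.

(** Otherwise summing over all levels would give the reverse inequality. This turns a count over
    many degrees into one in a single degree. *)
Lemma card_level_lt (A B : finType) (PA : {set A}) (PB : {set B})
    (f : A -> nat) (g : B -> nat) : (#|PB| < #|PA|)%N ->
  exists e, (#|[set b in PB | g b == e]%SET| < #|[set a in PA | f a == e]%SET|)%N.
Proof.
move=> BA; apply: contrapT => /forallNP H.
have {}H e : (#|[set a in PA | f a == e]%SET| <= #|[set b in PB | g b == e]%SET|)%N.
  by rewrite leqNgt; apply/negP.
move: BA; apply/negP; rewrite -leqNgt.
pose M := (\max_a f a).+1.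
have cardE (T : finType) (P : {set T}) (h : T -> nat) e :
    #|[set t in P | h t == e]%SET| = (\sum_(t in P) (h t == e))%N.
  rewrite -sum1_card big_mkcond [RHS]big_mkcond /=; apply: eq_bigr => t _.
  by rewrite inE; case: (t \in P) => //=; case: (h t == e).
have eqA : #|PA| = (\sum_(e < M) #|[set a in PA | f a == e]%SET|)%N.
  under eq_bigr do rewrite cardE.
  rewrite exchange_big -sum1_card; apply: eq_bigr => a _.
  have fM : (f a < M)%N by rewrite ltnS; apply: leq_bigmax.
  rewrite (bigD1 (Ordinal fM)) //= eqxx big1 // => i /eqP ne.
  by case: eqP => // E; case: ne; apply: val_inj.
have leB : (\sum_(e < M) #|[set b in PB | g b == e]%SET| <= #|PB|)%N.
  under eq_bigr do rewrite cardE.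
  rewrite exchange_big -sum1_card; apply: leq_sum => b _.
  have [gM|gM] := ltnP (g b) M.
    rewrite (bigD1 (Ordinal gM)) //= eqxx big1 // => i /eqP ne.
    by case: eqP => // E; case: ne; apply: val_inj.
  rewrite big1 // => i _; case: eqP => // E.
  by have := ltn_ord i; rewrite -E ltnNge gM.
rewrite eqA; apply: leq_trans leB; exact: leq_sum.
Qed.

Lemma card_ffun_ge d r N :
  (N ^ d <= #|[set u : {ffun 'I_d -> 'I_(r + N)} | [forall i, (r <= u i)%N]]%SET|)%N.
Proof.
pose f (v : {ffun 'I_d -> 'I_N}) : {ffun 'I_d -> 'I_(r + N)} :=
  [ffun i => rshift r (v i)].
have finj : injective f.
  move=> v w /ffunP E; apply/ffunP => i; have := E i; rewrite !ffunE.
  exact: rshift_inj.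
rewrite -card_ffun_ord -(card_imset _ finj); apply: subset_leq_card.
apply/fintype.subsetP => _ /imsetP[v _ ->]; rewrite inE; apply/forallP => i.
by rewrite ffunE /= leq_addr.
Qed.

Lemma card_ffun_lt_at d X k (i : 'I_d) :
  (#|[set u : {ffun 'I_d -> 'I_X} | (u i < k)%N]%SET| <= k * X ^ d.-1)%N.
Proof.
pose G (j : 'I_d) : {pred 'I_X} := [pred l : 'I_X | (j == i) ==> (l < k)%N].
have -> : #|[set u : {ffun 'I_d -> 'I_X} | (u i < k)%N]%SET| = #|family G|.
  apply: eq_card => u; rewrite inE; apply/idP/familyP => [uk j|/(_ i)].
    by rewrite inE; apply/implyP => /eqP ->.
  by rewrite inE eqxx.
rewrite card_family foldrE big_map big_enum /= (bigD1 i) //=; apply: leq_mul.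
  rewrite cardE -(size_map val) -[X in (_ <= X)%N](size_iota 0).
  apply: uniq_leq_size; first by rewrite (map_inj_uniq val_inj) enum_uniq.
  move=> _ /mapP[l + ->]; rewrite mem_enum inE eqxx /= => lk.
  by rewrite mem_iota add0n.
rewrite (eq_bigr (fun=> X)) => [|j /negPf ji].
  rewrite prod_nat_const cardC1 card_ord //.
by rewrite (eq_card (B := predT)) ?card_ord // => l; rewrite inE ji.
Qed.

End Counting.

(** * A form with a unit coefficient that vanishes on the generators of J modulo m I^e *)

Section HomogeneousDependence.
Variables (R : comNzRingType) (m : idealr R) (I J : set R).
Hypothesis Rlocal : local_ring m.
Variables (r d : nat) (x : 'I_d -> R) (K : finType) (W : K -> R).
Hypothesis Ix : forall i, I (x i).
Hypothesis JI : ideal_exp I r.+1 = ideal_mul J (ideal_exp I r).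
Hypothesis xJ : generates x J.
Hypothesis WI : ideal_exp I r = ideal_gen (range W).

Variables (n : nat -> nat) (b : 'I_d -> R).
Let N := mdeg (fun i : 'I_d => n i).
Let D (i : 'I_d) := mdeg (fun j : 'I_d => exp_step n i j).
Hypothesis Ib : forall i, ideal_exp I (N - D i) (b i).
Hypothesis rel : ideal_mul [set` m] (ideal_exp I N)
  (mon x (fun i => n i) +
   \sum_(i | (D i <= N)%N) b i * mon x (fun j => exp_step n i j)).

(* The relation rewrites x^n into monomials that are lexicographically larger;
   such a rewriting increases the weight below, which is bounded in each degree. *)
Let wt (u : 'I_d -> nat) := (\sum_(i < d) u i * N.+1 ^ (d - i))%N.

Let wtD u v : wt (fun i => u i + v i)%N = (wt u + wt v)%N.
Proof. by rewrite /wt -big_split; apply: eq_bigr => i _; rewrite mulnDl. Qed.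

Let wt_le u : (wt u <= mdeg u * N.+1 ^ d)%N.
Proof.
rewrite /wt /mdeg big_distrl /=; apply: leq_sum => i _.
by rewrite leq_mul2l leq_pexp2l ?leq_subr ?orbT.
Qed.

(** With q = (N+1)^(d-i-1), the larger exponent at i gains (N+1) q, while the exponents erased after
    i cost at most N q in total. *)
Let wt_step (i : 'I_d) : (wt (fun i => n i) < wt (fun j => exp_step n i j))%N.
Proof.
have id := ltn_ord i.
pose q := (N.+1 ^ (d - i).-1)%N.
have qE : (N.+1 ^ (d - i) = N.+1 * q)%N by rewrite -expnS prednK // subn_gt0.
have q0 : (0 < q)%N by rewrite expn_gt0.
have : (wt (fun i => n i) + \sum_(j < d) (j == i) * (N.+1 * q) <=
        wt (fun j => exp_step n i j) + \sum_(j < d) n j * q)%N.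
  rewrite /wt -!big_split /=; apply: leq_sum => j _; rewrite /exp_step.
  have [ji|ij|/val_inj ->] := ltngtP j i.
  - have /negPf -> : j != i by rewrite -val_eqE /= neq_ltn ji.
    by rewrite mul0n addn0 leq_addr.
  - have /negPf -> : j != i by rewrite -val_eqE /= neq_ltn ij orbT.
    rewrite !mul0n addn0 add0n leq_mul2l /q leq_pexp2l ?orbT //; lia.
  - by rewrite eqxx qE; lia.
rewrite (bigD1 i) //= eqxx big1 => [|j /negPf -> //].
rewrite -big_distrl /= -/(mdeg (fun i : 'I_d => n i)) -/N; nia.
Qed.

(** The span of the normal forms of the rewriting, namely the monomials not divisible by x^n, modulo
    m I^(r+e). *)
Let U e := ideal_add
  (ideal_gen [set z | exists u w,
     [/\ mdeg u = e, exists i : 'I_d, (u i < n i)%N & z = mon x u * W w]])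
  (ideal_mul [set` m] (ideal_exp I (r + e))).

Let U_ideal e : is_ideal (U e).
Proof.
by apply: ideal_add_ideal; [apply: ideal_gen_ideal|apply: ideal_mul_ideal].
Qed.

Let W_ideal w : ideal_exp I r (W w).
Proof. by rewrite WI; apply: sub_ideal_gen; exists w. Qed.

(** A monomial divisible by x^n is rewritten by [rel]. Expanding each [b i * W w] with
    [reduction_span] returns monomials of the same degree e and of larger weight, and [wt_le] bounds
    the weight. *)
Let mon_U e u w : mdeg u = e -> U e (mon x u * W w).
Proof.
have [k uk] := ubnP (e * N.+1 ^ d - wt u)%N; elim: k => // k IH in u w uk *.
move=> ue; have [lt|nlt] := pselect (exists i : 'I_d, (u i < n i)%N).
  apply: ideal_addl; first exact: ideal_mul_ideal.
  by apply: sub_ideal_gen; exists u, w.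
have nu (i : 'I_d) : (n i <= u i)%N.
  by rewrite leqNgt; apply/negP => lt; apply: nlt; exists i.
pose u0 (i : 'I_d) := (u i - n i)%N.
have uE : u = (fun i => u0 i + n i)%N.
  by apply: funext => i; rewrite /u0 subnK.
have eE : e = (mdeg u0 + N)%N by rewrite -ue {1}uE mdegD.
have rel' := rel; set S := \sum_(i | _) _ in rel'.
have -> : mon x u * W w =
    (mon x (fun i => n i) + S) * (mon x u0 * W w) - S * (mon x u0 * W w).
  by rewrite uE monD; ring.
apply: ideal_subr => //.
  apply: ideal_add_inr; first exact: ideal_gen_ideal.
  have -> : (r + e = N + (mdeg u0 + r))%N by rewrite eE; lia.
  apply: ideal_mul_expr rel' _; apply: ideal_expM => //; exact: mon_ideal_exp.
rewrite mulr_suml; apply: ideal_sum => // i DN.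
have -> : b i * mon x (fun j => exp_step n i j) * (mon x u0 * W w) =
    b i * W w * (mon x (fun j => exp_step n i j) * mon x u0) by ring.
have : ideal_exp I (r + (N - D i)) (b i * W w).
  by rewrite addnC; apply: ideal_expM.
move=> /(reduction_span JI xJ WI).
apply: ideal_gen_mulr => // _ [v [w' [vD ->]]].
have -> : mon x v * W w' * (mon x (fun j => exp_step n i j) * mon x u0) =
    mon x (fun j => v j + (exp_step n i j + u0 j))%N * W w'.
  by rewrite !monD; ring.
have degE : mdeg (fun j => v j + (exp_step n i j + u0 j))%N = e.
  by rewrite !mdegD vD -/(D i) eE; lia.
apply: IH => //.
have := wt_le (fun j => v j + (exp_step n i j + u0 j))%N; rewrite degE !wtD.
have := wt_step i; move: uk; rewrite uE wtD; lia.
Qed.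

Let exp_U e : ideal_exp I (r + e) `<=` U e.
Proof.
apply: (subset_trans (reduction_span JI xJ WI)).
apply: ideal_gen_sub => // _ [u [w [ue ->]]]; exact: mon_U.
Qed.

(** There are at least N0^d monomials in A, but the normal forms in B grow only like N0^(d-1). Hence
    in some degree e the monomials outnumber the normal forms spanning them and are dependent modulo
    m. *)
Lemma homogeneous_dependence_of_relation : (0 < d)%N ->
  exists L (e : nat) (c : {ffun 'I_d -> 'I_L} -> R),
    [/\ exists u, c u \notin m, forall u : {ffun 'I_d -> 'I_L}, mdeg (fun i => u i) != e -> c u = 0 &
      ideal_mul [set` m] (ideal_exp I e) (\sum_u c u * mon x (fun i => u i))].
Proof.
move=> d0.
(* X exceeds every degree occurring in A and is at most C N0, so B has at most #|K| N (C N0)^(d-1)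
   elements, fewer than N0^d. *)
pose C := (d * r.+1).+1.
pose N0 := (#|K| * N * C ^ d.-1).+1.
pose X := (d * (r + N0)).+1.
(* Exponents of at least r force the degree e to be at least r, since d > 0; [exp_U] concerns only
   such degrees. *)
pose A := [set u : {ffun 'I_d -> 'I_(r + N0)} | [forall i, (r <= u i)%N]]%SET.
pose B := [set p : {ffun 'I_d -> 'I_X} * K | [exists i : 'I_d, (p.1 i < n i)%N]]%SET.
have BA : (#|B| < #|A|)%N.
  apply: leq_trans (card_ffun_ge d r N0).
  have B_le : (#|B| <= #|K| * (N * X ^ d.-1))%N.
    have -> : B = finset.setX (\bigcup_(i < d) [set u : {ffun 'I_d -> 'I_X} | (u i < n i)%N])%SET
                    [set: K]%SET.
      apply/setP => -[u w]; rewrite !inE andbT /=.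
      apply/existsP/finset.bigcupP => [[i ui]|[i _]].
        by exists i => //; rewrite inE.
      by rewrite inE => ui; exists i.
    rewrite cardsX cardsT mulnC leq_mul2l; apply/orP; right.
    rewrite /N /mdeg big_distrl /=.
    elim/big_rec2: _ => [|i k Y _ IH]; first by rewrite cards0.
    apply: leq_trans (leq_card_setU _ _) _.
    by apply: leq_add => //; apply: card_ffun_lt_at.
  have XC : (X ^ d.-1 <= C ^ d.-1 * N0 ^ d.-1)%N.
    rewrite -expnMn; have [-> //|dp] := posnP d.-1; rewrite leq_exp2r // /X /C.
    have : (0 < N0)%N by []. nia.
  have N0d : (N0 ^ d = N0 * N0 ^ d.-1)%N by rewrite -expnS prednK.
  have : (0 < N0 ^ d.-1)%N by rewrite expn_gt0.
  rewrite N0d {2}/N0; nia.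
have [e Be] := card_level_lt (fun u : {ffun 'I_d -> 'I_(r + N0)} => mdeg (fun i => u i))
  (fun p : {ffun 'I_d -> 'I_X} * K => r + mdeg (fun i => p.1 i))%N BA.
set Ae := [set a in A | _]%SET in Be; set Bs := [set p in B | _]%SET in Be.
pose g (p : {ffun 'I_d -> 'I_X} * K) := mon x (fun i => p.1 i) * W p.2.
have /choice[M MP] : forall a : {ffun 'I_d -> 'I_(r + N0)},
    exists M : {ffun 'I_d -> 'I_X} * K -> R, a \in Ae ->
    ideal_mul [set` m] (ideal_exp I e)
      (mon x (fun i => a i) - \sum_(p in Bs) M p * g p).
  move=> a; have [aA|] := boolP (a \in Ae); last by exists (fun=> 0).
  move: aA; rewrite 2!inE => /andP[/forallP ra /eqP ae].
  have re : (r <= e)%N.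
    rewrite -ae /mdeg; apply: leq_trans (ra (Ordinal d0)) _.
    by rewrite (bigD1 (Ordinal d0)) //= leq_addr.
  have eE : e = (r + (e - r))%N by rewrite subnKC.
  have : U (e - r) (mon x (fun i => a i)).
    by apply: exp_U; rewrite -eE -ae; apply: mon_ideal_exp.
  rewrite /U -eE => -[y [z [gy mz E]]].
  suff [M yM] : exists M : {ffun 'I_d -> 'I_X} * K -> R, y = \sum_(p in Bs) M p * g p.
    by exists M => _; rewrite E yM [_ + z]addrC addrK.
  apply: ideal_gen_finPT; move: y gy {E}.
  apply: ideal_gen_sub => [|_ [u [w [ue [i ui] ->]]]]; first exact: ideal_gen_ideal.
  apply: sub_ideal_gen.
  have eX : (e <= d * (r + N0))%N.
    rewrite -ae /mdeg -[X in (_ <= X * _)%N]card_ord -sum_nat_const.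
    by apply: leq_sum => j _; apply: ltnW.
  have uX j : (u j < X)%N.
    have : (u j <= mdeg u)%N by rewrite /mdeg (bigD1 j) //= leq_addr.
    rewrite ue /X; lia.
  have uE : (fun i => [ffun i => Ordinal (uX i)] i : nat) = u.
    by apply: funext => j; rewrite ffunE.
  exists ([ffun i => Ordinal (uX i)], w); rewrite /g /= ?uE //.
  rewrite !inE /= uE ue -eE eqxx andbT; apply/existsP; exists i.
  by rewrite ffunE.
have [c [[a aA ca] c0 cM]] := residue_dependence Rlocal M Be.
exists (r + N0)%N, e, c; split.
- by exists a.
- move=> u ue; apply: c0; apply: contra ue.
  by rewrite !inE => /andP[].
have gI p : p \in Bs -> ideal_exp I e (g p).
  rewrite !inE => /andP[_ /eqP <-]; rewrite addnC; apply: ideal_expM => //.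
  exact: mon_ideal_exp.
have iM := ideal_mul_ideal [set` m] (ideal_exp I e).
(* The first sum is in m I^e by the choice of M, the second because c solves the linear system
   modulo m. *)
have -> : \sum_u c u * mon x (fun i => u i) =
    \sum_(u in Ae) c u * (mon x (fun i => u i) - \sum_(p in Bs) M u p * g p) +
    \sum_(p in Bs) (\sum_(u in Ae) c u * M u p) * g p.
  rewrite (bigID (mem Ae)) /= [X in _ + X]big1 ?addr0; last first.
    by move=> u /c0 ->; rewrite mul0r.
  under [X in _ + X]eq_bigr do rewrite mulr_suml.
  rewrite exchange_big -big_split /=; apply: eq_bigr => u _.
  under [X in _ + X]eq_bigr do rewrite -mulrA.
  by rewrite -mulr_sumr -mulrDr subrK.
apply: ideal_addr => //.
  by apply: ideal_sum => // u uA; apply: ideal_mulr => //; apply: MP.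
apply: ideal_sum => // p pB.
by apply: ideal_mulP; [apply: cM|apply: gI].
Qed.

End HomogeneousDependence.

Lemma homogeneous_dependence (R : comNzRingType) (m : idealr R) (I J : set R)
    (d : nat) (x : 'I_d -> R) :
  local_ring m -> noetherian R -> reduction I J -> generates x J -> (0 < d)%N ->
  (forall P : 'I_d.+1 -> prime_idealr (special_fiber m I), ~ prime_chain P) ->
  exists L (e : nat) (c : {ffun 'I_d -> 'I_L} -> R),
    [/\ exists u, c u \notin m, forall u : {ffun 'I_d -> 'I_L}, mdeg (fun i => u i) != e -> c u = 0 &
      ideal_mul [set` m] (ideal_exp I e) (\sum_u c u * mon x (fun i => u i))].
Proof.
move=> Rlocal Rnoeth [iJ sJI [r JI]] xJ d0 noP.
have Ix i : I (x i) by apply: sJI; rewrite -xJ; apply: sub_ideal_gen; exists i.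
have [k [W WI]] := Rnoeth _ (ideal_exp_ideal I r).
have [n [b [Ib rel]]] := analytic_spread_relation noP Ix.
exact: (homogeneous_dependence_of_relation Rlocal Ix JI xJ (esym WI) Ib rel).
Qed.

(** * Reductions generated by fewer elements *)

Lemma mon_congr (R : comNzRingType) (I K : set R) d (z z' : 'I_d -> R) u :
  (forall j, I (z j)) -> (forall j, I (z' j)) -> (forall j, K (z j - z' j)) ->
  ideal_mul K (ideal_exp I (mdeg u).-1) (mon z u - mon z' u).
Proof.
move=> Iz Iz' Kzz'.
(* The degree k is recorded so that a product of several congruences loses only one power of I in
   total. *)
pose cong k a a' := [/\ ideal_exp I k a, ideal_exp I k a' &
  ideal_mul K (ideal_exp I k.-1) (a - a')].
have cong1 : cong 0%N 1 1.
  by split=> //; rewrite subrr; apply: ideal_zero; apply: ideal_mul_ideal.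
have congM k l a a' b b' : cong k a a' -> cong l b b' ->
    cong (k + l)%N (a * b) (a' * b').
  move=> [Ia Ia' Kaa'] [Ib Ib' Kbb']; split; [exact: ideal_expM..|].
  have -> : a * b - a' * b' = (a - a') * b + (b - b') * a' by ring.
  apply: ideal_addr; first exact: ideal_mul_ideal.
    have := ideal_mul_expr Kaa' Ib; apply: ideal_mulS => //.
    by apply: ideal_exp_le; lia.
  have := ideal_mul_expr Kbb' Ia'; apply: ideal_mulS => //.
  by apply: ideal_exp_le; lia.
suff [] : cong (mdeg u) (mon z u) (mon z' u) by [].
rewrite /mdeg /mon; elim/big_rec3: _ => // j y1 y2 y3 _ IH; apply: (congM) => //.
elim: (u j) => // k IHk; rewrite !exprS -add1n; apply: congM => //.
split; [exact: ideal_exp1..|].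
by rewrite -[_ - _]mulr1; apply: ideal_mulP.
Qed.

Lemma infinite_residue_points (R : comNzRingType) (m : idealr R) L :
  infinite_set [set: {ideal_quot m}] ->
  exists e : 'I_L -> R, forall i j, i != j -> e i - e j \notin m.
Proof.
move=> /(infinite_set_fset L)[B _ LB].
exists (fun i => repr (nth 0 (finmap.enum_fset B) i)) => i j ij.
rewrite Quotient.idealrBE !reprK nth_uniq ?finmap.fset_uniq //; apply: leq_trans LB; exact: ltn_ord.
Qed.

(* If the degree-e form f vanishes on x modulo m I^e and f(l) is a unit, then
   over the residue field the coordinate change sending l to a coordinate axis
   makes f monic in one variable, which is thus integral over the others. *)
Lemma smaller_reduction (R : comNzRingType) (m : idealr R) (I J : set R)
    (d L : nat) (x : 'I_d -> R) (e : nat) (c : {ffun 'I_d -> 'I_L} -> R) :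
  local_ring m -> noetherian R -> infinite_set [set: {ideal_quot m}] ->
  is_ideal I -> reduction I J -> generates x J ->
  (exists u, c u \notin m) ->
  (forall u : {ffun 'I_d -> 'I_L}, mdeg (fun i => u i) != e -> c u = 0) ->
  ideal_mul [set` m] (ideal_exp I e) (\sum_u c u * mon x (fun i => u i)) ->
  exists (i : 'I_d) (y : 'I_d -> R),
    let K := ideal_gen [set y j | j in [set j | j != i]] in
    reduction I K /\ K `<=` J.
Proof.
move=> Rlocal Rnoeth kinf iI [iJ sJI [r JI]] xJ cu c0 rel.
have Jx i : J (x i) by rewrite -xJ; apply: sub_ideal_gen; exists i.
have Ix i : I (x i) by apply: sJI.
have [p pP] := infinite_residue_points L kinf.
have [l fl] := residue_nonvanishing Rlocal pP cu.
(* A form of degree 0 takes the same value at l and at x, but the first value is a unit and the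
   second is in m. *)
have e_gt0 : (0 < e)%N.
  rewrite lt0n; apply/eqP => e0; move: fl; apply/negP; rewrite negbK.
  have -> : \sum_u c u * mon l (fun i => u i) = \sum_u c u * mon x (fun i => u i).
    apply: eq_bigr => u _; have [ue|/c0 ->] := eqVneq (mdeg (fun i => u i)) e.
      congr (_ * _); apply: eq_bigr => i _; suff -> : u i = 0%N :> nat by [].
      by move/eqP: ue; rewrite e0 /mdeg sum_nat_eq0 => /forallP/(_ i)/eqP.
    by rewrite !mul0r.
  by have /(ideal_mul_subl (idealr_is_ideal m)) := rel.
have [i li] : exists i, l i \notin m.
  apply: contrapT => /forallNP lm; move: fl; apply/negP; rewrite negbK.
  apply: rpred_sum => u _; have [ue|/c0 ->] := eqVneq (mdeg (fun i => u i)) e.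
    apply: idealMr; move: e_gt0; rewrite -ue lt0n /mdeg sum_nat_eq0 negb_forall.
    move=> /existsP[j] /=; case E : (nat_of_ord (u j)) => [//|k] _.
    rewrite /mon (bigD1 j) //= E exprS mulrC; apply: idealMr; rewrite mulrC.
    by apply: idealMr; apply/negPn/negP; apply: lm.
  by rewrite mul0r idealr0.
(* Modulo K, l_i x_j is l_j x_i; hence l_i^e f(x) is congruent to f(l) x_i^e. *)
pose y j := l i * x j - l j * x i.
exists i, y => K.
have iK : is_ideal K by apply: ideal_gen_ideal.
have sKJ : K `<=` J.
  by apply: ideal_gen_sub => // _ [j _ <-]; apply: ideal_subr => //; apply: ideal_mulr.
have sKI : K `<=` I by apply: subset_trans sKJ sJI.
have Ky j : K (y j).
  have [->|ji] := eqVneq j i; last by apply: sub_ideal_gen; exists j.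
  by rewrite /y subrr; apply: ideal_zero.
split=> //; split=> //; exists (r + e).-1.
have reE : (r + e).-1.+1 = (r + e)%N by rewrite prednK // addn_gt0 e_gt0 orbT.
have monZ u : mon (fun j => l i * x j) u = l i ^+ mdeg u * mon x u.
  rewrite /mon; under eq_bigr do rewrite exprMn.
  by rewrite big_split /= prodrXr.
have monL u : mon (fun j => l j * x i) u = mon l u * x i ^+ mdeg u.
  rewrite /mon; under eq_bigr do rewrite exprMn.
  by rewrite big_split /= prodrXr.
have Kmon u : mdeg u = e -> ideal_mul K (ideal_exp I e.-1)
    (l i ^+ e * mon x u - mon l u * x i ^+ e).
  by move=> <-; rewrite -monZ -monL; apply: mon_congr => // j; apply: ideal_mulr.
(* V contains x_i^e, hence every monomial of degree e in the x_j. Thus I^(r+e) lies in K I^(r+e-1) +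
   m I^(r+e), and Nakayama's lemma applies. *)
pose V := ideal_add (ideal_mul K (ideal_exp I e.-1)) (ideal_mul [set` m] (ideal_exp I e)).
have iV : is_ideal V by apply: ideal_add_ideal; apply: ideal_mul_ideal.
have Vx : V (x i ^+ e).
  apply: (ideal_unitK Rlocal iV fl).
  have -> : (\sum_u c u * mon l (fun i => u i)) * x i ^+ e =
      l i ^+ e * (\sum_u c u * mon x (fun i => u i)) -
      \sum_u c u * (l i ^+ e * mon x (fun i => u i) - mon l (fun i => u i) * x i ^+ e).
    rewrite mulr_suml mulr_sumr -sumrB; apply: eq_bigr => u _; ring.
  apply: ideal_subr => //.
    apply: ideal_add_inr; first exact: ideal_mul_ideal.
    by apply: ideal_mulr => //; apply: ideal_mul_ideal.
  apply: ideal_addl; first exact: ideal_mul_ideal.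
  apply: ideal_sum => [|u _]; first exact: ideal_mul_ideal.
  have [ue|/c0 ->] := eqVneq (mdeg (fun i => u i)) e.
    by apply: ideal_mulr; [apply: ideal_mul_ideal|apply: Kmon].
  by rewrite mul0r; apply: ideal_zero; apply: ideal_mul_ideal.
have Vmon u : mdeg u = e -> V (mon x u).
  move=> ue; apply: (ideal_unitK Rlocal iV (local_expN Rlocal e li)).
  rewrite -[_ * _](subrK (mon l u * x i ^+ e)); apply: ideal_addr => //.
    by apply: ideal_addl; [apply: ideal_mul_ideal|apply: Kmon].
  exact: ideal_mulr.
rewrite reE; apply/seteqP; split; last first.
  by rewrite -{2}reE; apply: ideal_mulS.
apply: (nakayama Rlocal Rnoeth); [exact: ideal_exp_ideal|exact: ideal_mul_ideal|].
have [k [W WI]] := Rnoeth _ (ideal_exp_ideal I r).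
have iT := ideal_add_ideal (ideal_mul_ideal K (ideal_exp I (r + e).-1))
  (ideal_mul_ideal [set` m] (ideal_exp I (r + e))).
apply: (subset_trans (reduction_span JI xJ (esym WI))).
apply: ideal_gen_sub => // _ [u [w [/Vmon[a [b [Ka mb ->]]] ->]]].
have IW : ideal_exp I r (W w) by rewrite -WI; apply: sub_ideal_gen; exists w.
rewrite mulrDl; exists (a * W w), (b * W w); split=> //.
  have -> : (r + e).-1 = (e.-1 + r)%N by lia.
  exact: ideal_mul_expr.
by rewrite addnC; apply: ideal_mul_expr.
Qed.

(** * Generators of J indexed by the complement of T *)

Lemma mu_le_size (R : comNzRingType) (I : set R) s (l : seq R) :
  is_mu I s -> ideal_gen [set` l] = I -> (s <= size l)%N.
Proof.
move=> [_ mu] lI; apply: (mu _ (fun i : 'I_(size l) => l`_i)).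
rewrite /generates -lI; congr ideal_gen; apply/seteqP; split.
  by move=> _ [i _ <-] /=; apply: mem_nth.
move=> z /= zl; have zi : (index z l < size l)%N by rewrite index_mem.
by exists (Ordinal zi) => //=; rewrite nth_index.
Qed.

(** I^(r+1) = J I^r lies in K I^r + m I^(r+1), and Nakayama's lemma absorbs the last term. *)
Lemma reduction_of_residue (R : comNzRingType) (m : idealr R) (I J K : set R) :
  local_ring m -> noetherian R -> reduction I J -> is_ideal K -> K `<=` J ->
  J `<=` ideal_add K (ideal_mul [set` m] I) -> reduction I K.
Proof.
move=> Rlocal Rnoeth [iJ sJI [r JI]] iK sKJ JK.
have sKI := subset_trans sKJ sJI.
split=> //; exists r; apply/seteqP; split; last exact: ideal_mulS.
apply: (nakayama Rlocal Rnoeth); [exact: ideal_exp_ideal|exact: ideal_mul_ideal|].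
have iT := ideal_add_ideal (ideal_mul_ideal K (ideal_exp I r))
  (ideal_mul_ideal [set` m] (ideal_exp I r.+1)).
rewrite {1}JI; apply: ideal_mul_sub => // z b /JK[k [w [Kk mw ->]]] Ib.
rewrite mulrDl; exists (k * b), (w * b); split=> //; first exact: ideal_mulP.
apply: ideal_mul_gen_mulr mw => [|a i ma Ii]; first exact: ideal_mul_ideal.
by rewrite -mulrA; do 2![apply: ideal_mulP => //].
Qed.

Lemma complement_generators (R : comNzRingType) (m : idealr R) (I J : set R)
    s (h : 'I_s -> R) :
  local_ring m -> noetherian R -> is_ideal I -> minimal_reduction I J ->
  generates h I ->
  exists (T : {set 'I_s}) (a : 'I_s -> 'I_s -> R),
    let v i := h i + \sum_(j in T) a i j * h j in
    [/\ I `<=` ideal_add J (ideal_gen [set h j | j in [set j | j \in T]]),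
        forall i, i \in T -> forall j, a i j = - (i == j)%:R,
        forall i, J (v i) &
        J `<=` ideal_gen [set v i | i in [set i | i \notin T]]].
Proof.
move=> Rlocal Rnoeth iI [Jred Jmin] hI; have [iJ sJI _] := Jred.
have Ih i : I (h i) by rewrite -hI; apply: sub_ideal_gen; exists i.
pose hs (T : {set 'I_s}) := ideal_gen [set h j | j in [set j | j \in T]].
have ihs T : is_ideal (hs T) by apply: ideal_gen_ideal.
pose Q (T : {set 'I_s}) := `[< I `<=` ideal_add J (hs T) >].
have QT : Q [set: 'I_s]%SET.
  apply/asboolP; rewrite -{1}hI; apply: ideal_gen_sub => [|_ [i _ <-]].
    exact: ideal_add_ideal.
  by apply: ideal_add_inr => //; apply: sub_ideal_gen; exists i; rewrite //= inE.
have [T /asboolP IT Tmin] := arg_minnP (P := Q) (fun T : {set 'I_s} => #|T|) QT.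
have /choice[a aP] : forall i, exists a : 'I_s -> R,
    J (h i + \sum_(j in T) a j * h j) /\
    (i \in T -> forall j, a j = - (i == j)%:R).
  move=> i; have [iT|iT] := boolP (i \in T).
    (* For i in T these coefficients make v_i zero, so the indices in T contribute nothing to the
       generators. *)
    exists (fun j => - (i == j)%:R); split=> //.
    rewrite (bigD1 i) //= eqxx mulN1r big1 ?addr0 ?subrr; first exact: ideal_zero.
    by move=> j /andP[_]; rewrite eq_sym => /negPf ->; rewrite mulNr mul0r oppr0.
  have [z [w [Jz /ideal_gen_finPT[b ->] E]]] := IT _ (Ih i).
  exists (fun j => - b j); split=> //.
  rewrite E -addrA -big_split /= big1 ?addr0 // => j _.
  by rewrite mulNr subrr.
exists T, a => v; have Jv i : J (v i) by case: (aP i).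
split=> //; first by move=> i; case: (aP i).
set K := ideal_gen _.
have iK : is_ideal K by apply: ideal_gen_ideal.
have Kv i : K (v i).
  have [iT|iT] := boolP (i \in T); last by apply: sub_ideal_gen; exists i.
  suff -> : v i = 0 by apply: ideal_zero.
  rewrite /v (bigD1 i) //= (aP i).2 // eqxx mulN1r big1 ?addr0 ?subrr //.
  by move=> j /andP[_]; rewrite (aP i).2 // eq_sym => /negPf ->; rewrite mulNr mul0r oppr0.
have sKJ : K `<=` J by apply: ideal_gen_sub => // _ [i _ <-].
suff /Jmin/(_ sKJ) -> : reduction I K by [].
apply: (reduction_of_residue Rlocal Rnoeth Jred iK sKJ) => z Jz.
have : I z by apply: sJI.
rewrite -{1}hI => /ideal_gen_finP[b zE].
pose q j := - \sum_i b i * a i j.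
(* An element z of J is split into a combination of the v_i and one of the h_j with j in T; the
   latter is shown to lie in m I. *)
have zE' : z = \sum_i b i * v i + \sum_(j in T) q j * h j.
  rewrite zE; under [X in X + _]eq_bigr do rewrite /v mulrDr mulr_sumr.
  rewrite big_split /= -addrA exchange_big -big_split /= [X in _ + X]big1 ?addr0 //.
  by move=> j _; rewrite /q mulNr mulr_suml; under eq_bigr do rewrite mulrA; rewrite subrr.
rewrite zE'; exists (\sum_i b i * v i), (\sum_(j in T) q j * h j); split=> //.
  by apply: ideal_sum => // i _; apply: ideal_mulr.
apply: ideal_sum => [|j jT]; first exact: ideal_mul_ideal.
suff : q j \in m by move=> qm; apply: ideal_mulP.
(* A unit q_j would put h_j in J + (h_k : k in T, k <> j), against the minimality of T. *)
apply/negPn/negP => qj.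
have iD := ideal_add_ideal iJ (ihs (T :\ j)%SET).
have hj : ideal_add J (hs (T :\ j)%SET) (h j).
  apply: (ideal_unitK Rlocal iD qj).
  have -> : q j * h j = (z - \sum_i b i * v i) - \sum_(k in (T :\ j)%SET) q k * h k.
    by rewrite zE' (big_setD1 j) //=; ring.
  apply: ideal_subr => //.
    apply: ideal_addl => //; apply: ideal_subr => //.
    by apply: ideal_sum => // i _; apply: ideal_mulr.
  apply: ideal_add_inr => //; apply: ideal_sum => // k kT; apply: ideal_mulr => //.
  by apply: sub_ideal_gen; exists k.
have : Q (T :\ j)%SET.
  apply/asboolP; apply: (subset_trans IT); apply: ideal_add_sub => //.
    exact: ideal_addl.
  apply: ideal_gen_sub => // _ [k /= kT <-]; have [->//|kj] := eqVneq k j.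
  by apply: ideal_add_inr => //; apply: sub_ideal_gen; exists k; rewrite //= !inE kj.
by move/Tmin; rewrite (cardsD1 j T) jT; lia.
Qed.

(** * Comparison of the number of generators with the analytic spread *)

Theorem corollary3p3 (R : comNzRingType) (m : idealr R)
    (Rnoeth : noetherian R) (Rlocal : local_ring m)
    (kinf : infinite_set [set: {ideal_quot m}])
    (I : set R) (Iideal : is_ideal I)
    (s n : nat) (Imu : is_mu I s)
    (ns : (n <= s)%N) (Ispread : has_analytic_spread m I (s - n))
    (J : set R) (Jred : minimal_reduction I J)
    (h : 'I_s -> R) (hgen : minimal_generating h I) :
  exists (t : 'I_n -> 'I_s) (a : 'I_s -> 'I_n -> R),
    (forall i j : 'I_n, a (t i) j = - (i == j)%:R) /\
    generates (fun i : 'I_s => h i + \sum_(j < n) a i j * h (t j)) J.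
Proof.
have [hI _] := hgen.
have [T [a]] := complement_generators Rlocal Rnoeth Iideal Jred hI.
set v := fun i => h i + _; move=> [IT aT Jv Jgen].
have [[iJ sJI _] Jmin] := Jred.
pose d := #|~: T|.
have cT : (#|T| + d = s)%N by rewrite cardsC card_ord.
pose x (j : 'I_d) := v (enum_val j).
have xJ : generates x J.
  apply/seteqP; split; first by apply: ideal_gen_sub => // _ [j _ <-]; apply: Jv.
  apply: (subset_trans Jgen); apply: ideal_gen_sub => [|_ [i /= iT <-]].
    exact: ideal_gen_ideal.
  have iC : i \in ~: T by rewrite inE.
  apply: sub_ideal_gen; exists (enum_rank_in iC i) => //.
  by rewrite /x enum_rankK_in.
have [[P chP] maxP] := Ispread.
have sd : (s - n <= d)%N := analytic_spread_le Rlocal Rnoeth Jred.1 xJ chP.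
(* Otherwise the special fiber has no chain of d + 1 primes, so J is generated by d - 1 elements
   y_j; with the h_j for j in T they generate I, which gives only s - 1 generators. *)
have ds : (d <= s - n)%N.
  rewrite leqNgt; apply/negP => sd'.
  have noP (P' : 'I_d.+1 -> prime_idealr (special_fiber m I)) : ~ prime_chain P'.
    by move=> /maxP; rewrite leqNgt sd'.
  have [|L [e [c [cu c0 rel]]]] := homogeneous_dependence Rlocal Rnoeth Jred.1 xJ _ noP.
    by lia.
  have [i [y [Kred sKJ]]] :=
    smaller_reduction Rlocal Rnoeth kinf Iideal Jred.1 xJ cu c0 rel.
  have KJ := Jmin _ Kred sKJ.
  pose l := [seq y j | j <- enum (predC1 i)] ++ [seq h j | j <- enum T].
  have : (s <= size l)%N.
    apply: (mu_le_size Imu); apply/seteqP; split.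
      apply: ideal_gen_sub => // z; rewrite /= mem_cat => /orP[] /mapP[j jP ->].
        apply: sJI; rewrite -KJ; apply: sub_ideal_gen; exists j => //=.
        by move: jP; rewrite mem_enum.
      by rewrite -hI; apply: sub_ideal_gen; exists j.
    have il := ideal_gen_ideal [set` l].
    apply: (subset_trans IT); apply: ideal_add_sub => //.
      rewrite -KJ; apply: ideal_gen_sub => // _ [j /= ji <-]; apply: sub_ideal_gen.
      by rewrite /= mem_cat map_f // mem_enum.
    apply: ideal_gen_sub => // _ [j /= jT <-]; apply: sub_ideal_gen.
    by rewrite /= mem_cat orbC map_f // mem_enum.
  rewrite size_cat !size_map -!cardE cardC1 card_ord.
  rewrite -[X in (X <= _)%N]cT addnC leq_add2r.
  by have := ltn_ord i; lia.
(* Both inequalities give d = s - n, so T has n elements and its enumeration supplies the indices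
   t_j. *)
have nT : n = #|T| by lia.
subst n; exists enum_val, (fun i j => a i (enum_val j)); split=> [i j|].
  by rewrite aT ?enum_valP // (inj_eq enum_val_inj).
have vE i : h i + \sum_(j < #|T|) a i (enum_val j) * h (enum_val j) = v i.
  by rewrite /v [in RHS]big_enum_val.
rewrite /generates; under eq_fun do rewrite vE.
apply/seteqP; split; first by apply: ideal_gen_sub => // _ [i _ <-]; apply: Jv.
apply: (subset_trans Jgen); apply: ideal_gen_sub => [|_ [i _ <-]].
  exact: ideal_gen_ideal.
by apply: sub_ideal_gen; exists i.
Qed.
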